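(* Let $(M,Q)$ be a connected quaternionic manifold of dimension $4n\geq 8$, $D$ a self-dual quaternionic connection on $(M,Q)$ and $A\in\Gamma(Q)$. Then the distinguished section $\tilde A$ of the tangent vertical bundle $\Theta$ of the twistor fibration is $\bar\partial^D$-holomorphic if and only if $A$ is a solution of the Penrose operator $P^D$, i.e. $P^DA=0$.
   Context: A quaternionic structure on a manifold $M$ of dimension $4n\ge 8$ is a rank-3 subbundle $Q\subset\mathrm{End}(TM)$, locally generated by almost complex structures $J_1,J_2,J_3$ satisfying the quaternionic relations (an admissible basis), which is preserved by some torsion-free linear connection on $M$; any torsion-free linear connection preserving $Q$ is called a quaternionic connection. $Q$ carries the Euclidean metric $\langle\cdot,\cdot\rangle$ for which admissible bases are orthonormal; a quaternionic connection $D$ acts on $Q$ by $D_XA=[D_X,A]$ and preserves $\langle\cdot,\cdot\rangle$. $D$ is self-dual if the curvature $F$ of the connection induced by $D$ on $\Lambda^{4n}(T^*M)$ is $Q$-hermitian, i.e. $F(JX,JY)=F(X,Y)$ for all $J\in Q$ with $J^2=-\mathrm{Id}$. The twistor space $Z$ is the unit sphere bundle of $Q$, with projection $\pi:Z\to M$ and fibers $Z_p$; for $J\in Z_p$, $T_JZ_p=J^\perp\subset Q_p$. A quaternionic connection splits $T_JZ$ into $T_JZ_p$ and a horizontal space $\mathrm{Hor}_J\cong T_pM$. The (integrable) complex structure $\mathcal J$ of $Z$ is $A\mapsto J\circ A$ on $T_JZ_p$ and $J$ on $\mathrm{Hor}_J\cong T_pM$; it does not depend on the choice of quaternionic connection.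 $\Theta\to Z$ is the complex line bundle with fiber $\Theta_J=T_JZ_p=J^\perp\subset Q_p$, $p=\pi(J)$, with complex structure $\mathcal J(A)=J\circ A$. $\Pi:\pi^*Q\to\Theta$ is the orthogonal projection. For $A\in\Gamma(Q)$ the distinguished (or purely imaginary) section $\tilde A\in\Gamma(\Theta)$ is $\tilde A(J)=\Pi_J(A)=A-\langle A,J\rangle J$. For a self-dual $D$, the connection $\nabla:=\Pi\circ\pi^*D$ on $\Theta$ has $\mathcal J$-invariant curvature, and $\bar\partial^D_Us:=\frac12(\nabla_Us+\mathcal J\nabla_{\mathcal JU}s)$, $U\in TZ$, is a holomorphic structure of $\Theta$; $s$ is $\bar\partial^D$-holomorphic if $\bar\partial^Ds=0$. Penrose operator. Let $\mathbf E,\mathbf H$ be the locally defined complex vector bundles on $M$ associated to the standard representations of $GL(n,\mathbb H)$ on $E\cong\mathbb C^{2n}$ and of $Sp(1)$ on $H\cong\mathbb C^2$, via the $GL(n,\mathbb H)Sp(1)$-structure defined by $Q$. Then (real bundles being complexified) $TM\cong\mathbf E\otimes\mathbf H$, $T^*M\cong\mathbf E^*\otimes\mathbf H$, $Q\cong S^2(\mathbf H)$, and since $H\otimes S^2(H)\cong S^3(H)\oplus H$, $$T^*M\otimes Q\cong\mathbf E^*\otimes S^3(\mathbf H)\ \oplus\ \mathbf E^*\otimes\mathbf H .$$ (Equivalently, $\mathbf E^*\otimes S^3(\mathbf H)$ is the kernel of the contraction $T^*M\otimes Q\to T^*M$, $\alpha\otimes A\mapsto\alpha\circ A$, and $\mathbf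 E^*\otimes\mathbf H$ is the subbundle of elements $\sum_{i=1}^3(\alpha\circ J_i)\otimes J_i$, $\alpha\in T^*M$.) The Penrose operator $P^D:\Gamma(Q)\to\Gamma(\mathbf E^*\otimes S^3(\mathbf H))$ is the composition of $D:\Gamma(Q)\to\Gamma(T^*M\otimes Q)$ with the projection onto the first component. *)

(* Defs.v *)
From HB Require Import structures.
From mathcomp Require Import all_boot all_order all_algebra.
From mathcomp Require Import all_classical all_reals all_analysis.
Import Order.TTheory GRing.Theory Num.Theory.
Import numFieldNormedType.Exports.

Set Implicit Arguments.
Unset Strict Implicit.
Unset Printing Implicit Defensive.

Local Open Scope classical_set_scope.
Local Open Scope ring_scope.

(* Conventions.
   - Endomorphisms of R^m are matrices acting on column vectors, so J o A is
     J *m A.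
   - A manifold carries one preferred chart around each of its points, and the
     tangent space T_pM is R^m, read in the preferred chart at p.  Accordingly
     a vector field is a map M -> 'cV_m, a field of endomorphisms of TM is a
     map M -> 'M_m, and the value at q is to be read in the chart at q;
     smoothness near p is tested after transporting all values to the chart at p.
   - Local sections are total functions about which assumptions are only made
     near a point.  Differential operators act on germs, hence on local
     sections, and are R-linear, etc., on smooth ones. *)

Section Smooth.
Context {R : realType}.

(* For finite-dimensional V this is the usual notion of C^k on the open set U. *)
Fixpoint Ck (V W : normedModType R) (k : nat) (U : set V) (f : V -> W) : Prop :=
  if k is k'.+1 then
    (forall x, U x -> differentiable f x) /\ (forall v, Ck k' U ('D_v f))
  else forall x, U x -> {for x, continuous f}.

Definition smooth_near (V W : normedModType R) (x : V) (f : V -> W) : Prop :=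
  exists U : set V, [/\ open U, U x & forall k, Ck k U f].

Definition jac m (f : 'cV[R]_m -> 'cV[R]_m) (x : 'cV[R]_m) : 'M[R]_m :=
  \matrix_(i, j) ('D_(delta_mx j 0) f x) i 0.

End Smooth.

(* A smooth manifold of dimension m: the charts [chart p], p in M, form an atlas
   of the smooth structure.  A maximal atlas always contains such a family, and
   nothing below depends on which one is chosen. *)
Record manifold (R : realType) (m : nat) := Manifold {
  carrier :> topologicalType;
  hausdorffM : hausdorff_space carrier;
  second_countableM : @second_countable carrier;
  dom : carrier -> set carrier;
  chart : carrier -> carrier -> 'cV[R]_m;
  chartV : carrier -> 'cV[R]_m -> carrier;
  open_dom : forall p, open (dom p);
  mem_dom : forall p, dom p p;
  chartK : forall p q, dom p q -> chartV p (chart p q) = q;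
  open_image : forall p, open (chart p @` dom p);
  chart_continuous : forall p q, dom p q -> {for q, continuous (chart p)};
  chartV_continuous : forall p x, (chart p @` dom p) x ->
    {for x, continuous (chartV p)};
  chart_smooth : forall p q x, (chart p @` (dom p `&` dom q)) x ->
    smooth_near x (chart q \o chartV p) }.

Section Fields.
Context {R : realType} {m : nat} {M : manifold R m}.
Implicit Types (p q : M) (X Y : M -> 'cV[R]_m) (A : M -> 'M[R]_m) (f : M -> R).

(* The isomorphism from T_qM to R^m given by the chart at p, for q in dom p. *)
Definition tcoord p q : 'M[R]_m := jac (chart p \o chartV q) (chart q q).

Definition end_coord p q (a : 'M[R]_m) : 'M[R]_m :=
  tcoord p q *m a *m invmx (tcoord p q).

Definition fun_in p f : 'cV[R]_m -> R := f \o chartV p.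
Definition vec_in p X : 'cV[R]_m -> 'cV[R]_m :=
  fun x => tcoord p (chartV p x) *m X (chartV p x).
Definition end_in p A : 'cV[R]_m -> 'M[R]_m :=
  fun x => end_coord p (chartV p x) (A (chartV p x)).

Definition smooth_fun p f := smooth_near (W := R^o) (chart p p) (fun_in p f).
Definition smooth_vec p X := smooth_near (chart p p) (vec_in p X).
Definition smooth_end p A := smooth_near (chart p p) (end_in p A).

(* Fields with constant coefficients in the chart at p and given value at p. *)
Definition ext_vec p (v : 'cV[R]_m) : M -> 'cV[R]_m :=
  fun q => invmx (tcoord p q) *m v.
Definition ext_end p (a : 'M[R]_m) : M -> 'M[R]_m :=
  fun q => invmx (tcoord p q) *m a *m tcoord p q.

Definition dfun p (v : 'cV[R]_m) f : R :=
  'D_v (fun_in p f : 'cV[R]_m -> R^o) (chart p p).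

Definition bracket X Y : M -> 'cV[R]_m := fun p =>
  'D_(X p) (vec_in p Y) (chart p p) - 'D_(Y p) (vec_in p X) (chart p p).

End Fields.

Record connection (R : realType) (m : nat) (M : manifold R m) := Connection {
  cov :> forall p : M, 'cV[R]_m -> (M -> 'cV[R]_m) -> 'cV[R]_m;
  cov_local : forall p v (X Y : M -> 'cV[R]_m), smooth_vec p X ->
    (\forall q \near p, X q = Y q) -> cov p v X = cov p v Y;
  cov_linear : forall p a v w Y, smooth_vec p Y ->
    cov p (a *: v + w) Y = a *: cov p v Y + cov p w Y;
  covD : forall p v X Y, smooth_vec p X -> smooth_vec p Y ->
    cov p v (fun q => X q + Y q) = cov p v X + cov p v Y;
  cov_leibniz : forall p v f Y, smooth_fun p f -> smooth_vec p Y ->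
    cov p v (fun q => f q *: Y q) = dfun p v f *: Y p + f p *: cov p v Y;
  cov_smooth : forall p (X Y : M -> 'cV[R]_m), smooth_vec p X ->
    smooth_vec p Y -> smooth_vec p (fun q => cov q (X q) Y) }.

Section Connections.
Context {R : realType} {m : nat} {M : manifold R m}.
Implicit Types (p q : M) (X Y : M -> 'cV[R]_m) (A : M -> 'M[R]_m)
  (D : connection M).

Definition torsion_free D := forall p X Y, smooth_vec p X -> smooth_vec p Y ->
  D p (X p) Y - D p (Y p) X = bracket X Y p.

(* (D_v A) y = D_v (A Y) - A (D_v Y), Y being a local extension of y. *)
Definition cov_end D p (v : 'cV[R]_m) A : 'M[R]_m :=
  \matrix_(i, j)
    (let Y := ext_vec p (delta_mx j 0) in
     D p v (fun q => A q *m Y q) - A p *m D p v Y) i 0.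

(* Top-degree forms, i.e. sections of Lambda^m(T^*M). *)
Definition upd (u : 'I_m -> 'cV[R]_m) (i : 'I_m) (x : 'cV[R]_m) :=
  fun j => if j == i then x else u j.

Definition alternating_form (w : ('I_m -> 'cV[R]_m) -> R) :=
  (forall u i a x y,
     w (upd u i (a *: x + y)) = a * w (upd u i x) + w (upd u i y)) /\
  (forall u i j, i != j -> u i = u j -> w u = 0).

Definition smooth_form p (w : M -> ('I_m -> 'cV[R]_m) -> R) :=
  (\forall q \near p, alternating_form (w q)) /\
  forall X : 'I_m -> M -> 'cV[R]_m, (forall i, smooth_vec p (X i)) ->
    smooth_fun p (fun q => w q (fun i => X i q)).

Definition cov_form D p (v : 'cV[R]_m) (w : M -> ('I_m -> 'cV[R]_m) -> R) :
    ('I_m -> 'cV[R]_m) -> R := fun u =>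
  dfun p v (fun q => w q (fun i => ext_vec p (u i) q))
  - \sum_i w p (upd u i (D p v (ext_vec p (u i)))).

(* F(X,Y)w for the curvature F of the connection induced on Lambda^m(T^*M). *)
Definition curv_form D X Y (w : M -> ('I_m -> 'cV[R]_m) -> R) p :
    ('I_m -> 'cV[R]_m) -> R := fun u =>
  cov_form D p (X p) (fun q => cov_form D q (Y q) w) u
  - cov_form D p (Y p) (fun q => cov_form D q (X q) w) u
  - cov_form D p (bracket X Y p) w u.

End Connections.

Section Quaternionic.
Context {R : realType} {m : nat}.

Definition admissible (Qp : set 'M[R]_m) (J1 J2 J3 : 'M[R]_m) :=
  [/\ J1 *m J1 = - 1%:M, J2 *m J2 = - 1%:M, J1 *m J2 = J3, J2 *m J1 = - J3
    & Qp = [set A | exists a1 a2 a3, A = a1 *: J1 + a2 *: J2 + a3 *: J3]].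

(* The metric on Q for which admissible bases are orthonormal, see
   [admissible_orthonormal]. *)
Definition qdot (A B : 'M[R]_m) : R := - \tr (A *m B) / m%:R.

Lemma admissible_orthonormal Qp J1 J2 J3 : (0 < m)%N ->
  admissible Qp J1 J2 J3 ->
  [/\ qdot J1 J1 = 1, qdot J2 J2 = 1 & qdot J3 J3 = 1] /\
  [/\ qdot J1 J2 = 0, qdot J2 J3 = 0 & qdot J1 J3 = 0].
Proof.
move=> m0 [J11 J22 J12 J21 _].
have m0' : m%:R != 0 :> R by rewrite pnatr_eq0 -lt0n.
have tr0 (A : 'M[R]_m) : \tr A = - \tr A -> \tr A = 0.
  by move/eqP; rewrite -addr_eq0 -mulr2n mulrn_eq0 /= => /eqP.
have J13 : J1 *m J3 = - J2 by rewrite -J12 mulmxA J11 mulNmx mul1mx.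
have J31 : J3 *m J1 = J2.
  by rewrite -[J3]opprK -J21 mulNmx -mulmxA J11 mulmxN mulmx1 opprK.
have J23 : J2 *m J3 = J1.
  by rewrite -[J3]opprK -J21 mulmxN mulmxA J22 mulNmx mul1mx opprK.
have J32 : J3 *m J2 = - J1 by rewrite -J12 -mulmxA J22 mulmxN mulmx1.
have J33 : J3 *m J3 = - 1%:M by rewrite -{1}J12 -mulmxA J23.
have t1 : \tr J1 = 0.
  by apply: tr0; rewrite -{1}J23 mxtrace_mulC J32 raddfN.
have t2 : \tr J2 = 0.
  by apply: tr0; rewrite -{1}J31 mxtrace_mulC J13 raddfN.
have t3 : \tr J3 = 0.
  by apply: tr0; rewrite -{1}J12 mxtrace_mulC J21 raddfN.
rewrite /qdot J11 J22 J33 J12 J23 J13 !raddfN /= mxtrace1 opprK divff //.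
by split; split; rewrite ?t1 ?t2 ?t3 ?oppr0 ?mul0r.
Qed.

Context {M : manifold R m}.
Implicit Types (p q : M) (Q : M -> set 'M[R]_m) (A : M -> 'M[R]_m)
  (D : connection M).

Definition preserves Q D := forall p v A, smooth_end p A ->
  (\forall q \near p, Q q (A q)) -> Q p (cov_end D p v A).

Definition quaternionic_connection Q D := torsion_free D /\ preserves Q D.

Definition quaternionic_structure Q :=
  (forall p, exists J1 J2 J3 : M -> 'M[R]_m,
     [/\ smooth_end p J1, smooth_end p J2, smooth_end p J3
       & \forall q \near p, admissible (Q q) (J1 q) (J2 q) (J3 q)]) /\
  exists D : connection M, quaternionic_connection Q D.

Definition section_of Q A := forall p, smooth_end p A /\ Q p (A p).

(* F(JX,JY) = F(X,Y) at p; X' and Y' are local fields extending JX and JY. *)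
Definition self_dual Q D := forall p J, Q p J -> J *m J = - 1%:M ->
  forall X Y X' Y' : M -> 'cV[R]_m,
  smooth_vec p X -> smooth_vec p Y -> smooth_vec p X' -> smooth_vec p Y' ->
  X' p = J *m X p -> Y' p = J *m Y p ->
  forall w, smooth_form p w -> forall u,
  curv_form D X' Y' w p u = curv_form D X Y w p u.

End Quaternionic.

(* The twistor space Z, as a submanifold of the total space of End(TM).  A point
   of the latter is a pair (q, a); over dom p it has coordinates [zcoord p],
   with values in R^m x 'M_m.  Tangent vectors of Z at (p, J) are velocities of
   curves in Z, in the coordinates at p; thus dpi(U) = U.1, and T_J Z_p consists
   of the pairs (0, B) with B in Q_p orthogonal to J. *)
Section Twistor.
Context {R : realType} {m : nat} {M : manifold R m}.
Variables (Q : M -> set 'M[R]_m) (D : connection M).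
Implicit Types (p q : M) (J : 'M[R]_m) (U : 'cV[R]_m * 'M[R]_m)
  (s : M * 'M[R]_m -> 'M[R]_m) (c : R -> M * 'M[R]_m).

Definition twistor : set (M * 'M[R]_m) :=
  [set z | Q z.1 z.2 /\ qdot z.2 z.2 = 1].

Definition zcoord p (z : M * 'M[R]_m) : 'cV[R]_m * 'M[R]_m :=
  (chart p z.1, end_coord p z.1 z.2).

Definition zcurve p J U c :=
  [/\ c 0 = (p, J), \forall t \near (0 : R), dom p (c t).1 /\ twistor (c t),
      smooth_near (V := R^o) 0 (zcoord p \o c)
    & derive1 (zcoord p \o c) 0 = U].

Definition tangentZ p J : set ('cV[R]_m * 'M[R]_m) :=
  [set U | exists c, zcurve p J U c].

(* (pi^*D)_U s for a section s of pi^*Q, s(q, a) being in Q_q.  Writing s =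
   sum_ij s_ij pi^*E_ij for the local frame E_ij of End(TM) given by the chart
   at p, this is sum_ij (U(s_ij) E_ij + s_ij D_(dpi U) E_ij); the first sum is
   computed along any curve with velocity U. *)
Definition pull_cov p J U s : 'M[R]_m := xget 0
  [set W | exists2 c, zcurve p J U c &
    W = derive1 (fun t => end_coord p (c t).1 (s (c t))) 0
        + cov_end D p U.1 (ext_end p (s (p, J)))].

(* The splitting of T_J Z defined by D.  A curve (q(t), J(t)) in Z is horizontal
   iff J(t) is D-parallel along q(t); with U its velocity this reads
   U.2 + D_(U.1) (ext_end p J) = 0. *)
Definition vert p J U : 'M[R]_m := U.2 + cov_end D p U.1 (ext_end p J).

Lemma derive1_snd (V W : normedModType R) (f : R^o -> V * W) (t : R) :
  differentiable f t -> derive1 (fun t => (f t).2) t = (derive1 f t).2.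
Proof.
move=> df.
pose g : {linear (V * W)%type -> W} := snd.
have cg : continuous g by move=> x; exact: cvg_snd.
have dg : differentiable g (f t) by exact: linear_differentiable.
rewrite (derive1E' (f := g \o f)); last exact: differentiable_comp.
by rewrite diff_comp // diff_lin // derive1E'.
Qed.

(* [vert] is the covariant derivative of the tautological section J |-> J. *)
Lemma vert_pull_cov p J U : tangentZ p J U -> vert p J U = pull_cov p J U snd.
Proof.
move=> [c0 c0U]; rewrite /vert /pull_cov.
case: xgetP => [W -> [c [_ _ [V [_ V0 sc]] <-] ->]|].
  2: by move=> /(_ _ (ex_intro2 _ _ c0 c0U erefl)).
congr (_ + _); have [dc _] := sc 1%N.
by rewrite -(derive1_snd (dc _ V0)).
Qed.

Definition hlift p J (v : 'cV[R]_m) : 'cV[R]_m * 'M[R]_m :=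
  (v, - cov_end D p v (ext_end p J)).

Definition cplxZ p J U : 'cV[R]_m * 'M[R]_m :=
  hlift p J (J *m U.1) + (0, J *m vert p J U).

Definition Theta_proj J (a : 'M[R]_m) : 'M[R]_m := a - qdot a J *: J.

Definition nabla p J U s : 'M[R]_m := Theta_proj J (pull_cov p J U s).

Definition dbar p J U s : 'M[R]_m :=
  2^-1 *: (nabla p J U s + J *m nabla p J (cplxZ p J U) s).

Definition dbar_holomorphic s := forall p J, twistor (p, J) ->
  forall U, tangentZ p J U -> dbar p J U s = 0.

Definition distinguished (A : M -> 'M[R]_m) : M * 'M[R]_m -> 'M[R]_m :=
  fun z => Theta_proj z.2 (A z.1).

End Twistor.

(* Elements of T_p^*M (x) Q_p are linear maps T_pM -> Q_p; covectors are rows. *)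
Section Penrose.
Context {R : realType} {m : nat}.
Implicit Types (Qp : set 'M[R]_m) (phi : 'cV[R]_m -> 'M[R]_m).

Definition cotensor Qp : set ('cV[R]_m -> 'M[R]_m) :=
  [set phi | (forall a u v, phi (a *: u + v) = a *: phi u + phi v) /\
             forall v, Qp (phi v)].

(* The contraction alpha (x) A |-> alpha o A. *)
Definition contraction phi : 'rV[R]_m := \sum_i row i (phi (delta_mx i 0)).

Definition ES3H Qp : set ('cV[R]_m -> 'M[R]_m) :=
  [set phi | cotensor Qp phi /\ contraction phi = 0].

Definition EH Qp : set ('cV[R]_m -> 'M[R]_m) :=
  [set phi | exists J1 J2 J3, admissible Qp J1 J2 J3 /\
    exists alpha : 'rV[R]_m, forall v,
    phi v = (alpha *m J1 *m v) 0 0 *: J1 + (alpha *m J2 *m v) 0 0 *: J2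
            + (alpha *m J3 *m v) 0 0 *: J3].

Definition ES3H_proj Qp phi : 'cV[R]_m -> 'M[R]_m :=
  xget (fun=> 0) [set psi | ES3H Qp psi /\ EH Qp (fun v => phi v - psi v)].

Definition penrose {M : manifold R m} (Q : M -> set 'M[R]_m)
    (D : connection M) (A : M -> 'M[R]_m) (p : M) : 'cV[R]_m -> 'M[R]_m :=
  ES3H_proj (Q p) (fun v => cov_end D p v A).

End Penrose.

(* Main.v *)
From HB Require Import structures.
Require Import Defs.
From mathcomp Require Import all_boot all_order all_algebra.
From mathcomp Require Import all_classical all_reals all_analysis.
From mathcomp Require Import ring lra.
Import Order.TTheory GRing.Theory Num.Theory.
Import numFieldNormedType.Exports.

(* Write At for the distinguished section of A.  In the chart at p a connection reads D_v A = d_v A + [Gamma_v, A].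
   Differentiating A - <A, J> J along a curve in Z with velocity U and
   projecting to the orthogonal complement of J yields
     nabla_U At = Pi_J (D_v A) - <A, J> V,
   where v = dpi(U) and V is the vertical part of U.  As J o V is the vertical
   part of the image of U under the complex structure of Z and J o J = -1, the
   V-terms cancel in dbar, leaving
     2 dbar_U At = Pi_J (D_v A) + J o Pi_J (D_(Jv) A).
   Every v is dpi(U) for some U, so At is holomorphic iff phi = DA satisfies
     Pi_J (phi v) + J o Pi_J (phi (J v)) = 0   for all unit J in Q_p, all v.
   In an admissible basis, taking J = J1 and J = J2 already forces
   phi = sum_i (alpha o J_i) (x) J_i, i.e. phi in E^* (x) H, which in turn
   implies the identity for every J; and E^* (x) H is the kernel of the
   projection onto E^* (x) S^3 H.  Curves in Z with a given velocity are written as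
   t |-> sum_i f_i(t) J_i, with J_i a local admissible frame along a straight
   line in the chart and (f_i) a curve on the unit sphere of R^3. *)

Set Implicit Arguments.
Unset Strict Implicit.
Unset Printing Implicit Defensive.

Local Open Scope classical_set_scope.
Local Open Scope ring_scope.

(** * Calculus of C^k maps *)

Section Calculus.
Context {R : realType}.
Implicit Types (V W : normedModType R).

(** The difference [g - f] vanishes near [x], so it is differentiable there with zero differential,
    and [g] is a sum of differentiable maps. *)
Lemma near_eq_differentiable V W (f g : V -> W) x :
  {near x, f =1 g} -> differentiable f x -> differentiable g x.
Proof.
move=> fg df; have -> : g = f + (g - f) by rewrite addrC subrK.
apply: differentiableD => //; set h := g - f.
have h0 : \forall y \near x, h y = 0.
  by apply: filterS fg => y fgy; rewrite /h [LHS](_ : _ = g y - f y) // -fgy subrr.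
(* A first-order expansion of [h] with zero linear part; uniqueness of the expansion then identifies
   the differential of [h] at [x] with 0. *)
have d0 : h \o shift x = cst (h x) + (\0 : {linear V -> W}) +o_ (0 : V) id.
  apply/eqaddoP => e e0.
  have : \forall y \near (0 : V), h (y + x) = 0.
    by move: h0; rewrite (near_shift 0) /= subr0.
  apply: filterS => y hy /=.
  rewrite [X in `|X|](_ : _ = h (y + x) - (h x + 0)) //.
  by rewrite hy (nbhs_singleton h0) addr0 subr0 normr0 mulr_ge0 // ltW.
have c0 : continuous (\0 : {linear V -> W}) by move=> y; exact: cst_continuous.
apply/diff_locallyP; rewrite (diff_unique c0 d0); split => //.
Qed.

Lemma derive_linear V W W' (l : {linear W -> W'}) (f : V -> W) x v :
  continuous l -> differentiable f x ->
  differentiable (l \o f) x /\ 'D_v (l \o f) x = l ('D_v f x).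
Proof.
move=> cl df; have dl : differentiable l (f x) by exact: linear_differentiable.
have dlf : differentiable (l \o f) x by exact: differentiable_comp.
by split; rewrite // (deriveE _ dlf) (deriveE _ df) diff_comp // diff_lin.
Qed.

Lemma derive_pair V W W' (f : V -> W) (g : V -> W') x v :
  differentiable f x -> differentiable g x ->
  'D_v (fun y => (f y, g y)) x = ('D_v f x, 'D_v g x).
Proof.
move=> df dg; rewrite (deriveE _ df) (deriveE _ dg) deriveE ?diff_pair //.
exact: differentiable_pair.
Qed.

Lemma derive_comp V W W' (g : W -> W') (f : V -> W) x v :
  differentiable f x -> differentiable g (f x) ->
  'D_v (g \o f) x = 'D_('D_v f x) g (f x).
Proof.
move=> df dg; have dgf : differentiable (g \o f) x by exact: differentiable_comp.
by rewrite (deriveE _ df) (deriveE _ dg) (deriveE _ dgf) diff_comp.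
Qed.

Lemma derive_bilinear V W W' W'' (b : {bilinear W -> W' -> W''})
    (f : V -> W) (g : V -> W') x v :
  continuous (fun p => b p.1 p.2) -> differentiable f x -> differentiable g x ->
  differentiable (fun y => b (f y) (g y)) x /\
  'D_v (fun y => b (f y) (g y)) x = b (f x) ('D_v g x) + b ('D_v f x) (g x).
Proof.
move=> cb df dg; pose h y := (f y, g y).
have dh : differentiable h x by exact: differentiable_pair.
have db : differentiable (fun p => b p.1 p.2) (h x) by exact: differentiable_bilin.
split; first exact: (differentiable_comp dh db).
rewrite (_ : (fun y => _) = (fun p => b p.1 p.2) \o h) // derive_comp //.
by rewrite deriveE // diff_bilin // /h derive_pair.
Qed.

(** Openness turns equality on [U] into equality near each point of [U], so the derivatives agree on
    [U] too. The inductions below rely on this, because their formulas for ['D_v f] hold only on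
    [U]. *)
Lemma Ck_eq V W k (U : set V) (f g : V -> W) : open U ->
  (forall x, U x -> f x = g x) -> Ck k U f -> Ck k U g.
Proof.
move=> oU; elim: k f g => [|k IH] f g fg /=.
  move=> cf x Ux; have nfg : \forall y \near x, f y = g y.
    by have := open_nbhs_nbhs (conj oU Ux); exact: filterS.
  change (g @ x --> g x); rewrite -(fg _ Ux); apply: cvg_trans (cf x Ux).
  by apply: near_eq_cvg; apply: filterS nfg => y /esym.
move=> [df Df]; have nfg x : U x -> \forall y \near x, f y = g y.
  by move=> Ux; have := open_nbhs_nbhs (conj oU Ux); exact: filterS.
split=> [x Ux|v]; first by apply: near_eq_differentiable (df _ Ux); exact: nfg.
by apply: IH (Df v) => x Ux; apply: near_eq_derive; exact: nfg.
Qed.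

Lemma Ck_subset V W k (U U' : set V) (f : V -> W) :
  U' `<=` U -> Ck k U f -> Ck k U' f.
Proof.
move=> sU; elim: k f => [|k IH] f /=; first by move=> cf x /sU /cf.
by move=> [df Df]; split=> [x /sU /df //|v]; exact: IH.
Qed.

Lemma Ck_le V W k (U : set V) (f : V -> W) : Ck k.+1 U f -> Ck k U f.
Proof.
elim: k f => [|k IH] f [df Df] /=.
  by move=> x /df; exact: differentiable_continuous.
by split=> // v; exact/IH/Df.
Qed.

Lemma Ck_cst V W k (U : set V) (a : W) : Ck k U (fun=> a).
Proof.
elim: k a => [|k IH] a /=; first by move=> x _; exact: cst_continuous.
split=> [x _|v]; first exact: differentiable_cst.
rewrite (_ : 'D_v _ = fun=> 0); first exact: IH.
by apply/funext => x; exact: derive_cst.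
Qed.

Lemma Ck_linear V W W' k (U : set V) (l : {linear W -> W'}) (f : V -> W) :
  open U -> continuous l -> Ck k U f -> Ck k U (l \o f).
Proof.
move=> oU cl; elim: k f => [|k IH] f /=.
  by move=> cf x Ux; apply: continuous_comp; [exact: cf|exact: cl].
move=> [df Df]; split=> [x Ux|v]; first by case: (derive_linear 0 cl (df _ Ux)).
apply: Ck_eq (IH _ (Df v)) => // x Ux /=.
by case: (derive_linear v cl (df _ Ux)).
Qed.

Lemma CkD V W k (U : set V) (f g : V -> W) : open U ->
  Ck k U f -> Ck k U g -> Ck k U (fun x => f x + g x).
Proof.
move=> oU; elim: k f g => [|k IH] f g /=.
  by move=> cf cg x Ux; apply: cvgD; [exact: cf|exact: cg].
move=> [df Df] [dg Dg]; split=> [x Ux|v].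
  by apply: differentiableD; [exact: df|exact: dg].
apply: Ck_eq (IH _ _ (Df v) (Dg v)) => // x Ux.
by rewrite deriveD //; apply: diff_derivable; [exact: df|exact: dg].
Qed.

Lemma Ck_pair V W W' k (U : set V) (f : V -> W) (g : V -> W') : open U ->
  Ck k U f -> Ck k U g -> Ck k U (fun x => (f x, g x)).
Proof.
move=> oU; elim: k f g => [|k IH] f g /=.
  by move=> cf cg x Ux; apply: cvg_pair; [exact: cf|exact: cg].
move=> [df Df] [dg Dg]; split=> [x Ux|v].
  by apply: differentiable_pair; [exact: df|exact: dg].
apply: Ck_eq (IH _ _ (Df v) (Dg v)) => // x Ux.
by rewrite derive_pair //; [exact: df|exact: dg].
Qed.

(** By the Leibniz rule the derivative is a sum of two terms of the same shape, with one factor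
    differentiated and the other lowered by one order through [Ck_le]. *)
Lemma Ck_bilinear V W W' W'' k (U : set V) (b : {bilinear W -> W' -> W''})
    (f : V -> W) (g : V -> W') :
  open U -> continuous (fun p => b p.1 p.2) ->
  Ck k U f -> Ck k U g -> Ck k U (fun x => b (f x) (g x)).
Proof.
move=> oU cb; elim: k f g => [|k IH] f g.
  move=> /= cf cg x Ux; apply: (@continuous_comp _ _ _ (fun y => (f y, g y))
    (fun p => b p.1 p.2)); last exact: cb.
  by apply: cvg_pair; [exact: cf|exact: cg].
move=> Cf Cg; have [df Df] := Cf; have [dg Dg] := Cg; split=> [x Ux|v].
  by case: (derive_bilinear 0 cb (df _ Ux) (dg _ Ux)).
apply: (Ck_eq oU (f := fun x => b (f x) ('D_v g x) + b ('D_v f x) (g x))).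
  by move=> x Ux; case: (derive_bilinear v cb (df _ Ux) (dg _ Ux)).
by apply: CkD => //; apply: IH; first [exact: Df | exact: Dg | exact: Ck_le].
Qed.

Lemma derive_line V (x v : V) (t w : R^o) :
  differentiable (fun s : R^o => x + s *: v) t /\
  'D_w (fun s : R^o => x + s *: v) t = w *: v.
Proof.
have di : differentiable (id : R^o -> R^o) t by have [] := is_diff_id t.
have d1 : differentiable (fun s : R^o => s *: v) t.
  exact: (@differentiableZl R R^o V id v t).
have d2 : differentiable (cst x : R^o -> V) t by exact: differentiable_cst.
have -> : (fun s : R^o => x + s *: v) = cst x + (fun s : R^o => s *: v) by [].
split; first exact: differentiableD.
rewrite deriveD ?derive_cst ?add0r; try exact: diff_derivable.
rewrite deriveE // (@diffZl R R^o V id v t) //.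
by have [_ ->] := is_diff_id t.
Qed.

(** Along a line the chain rule produces ['D_(w *: v) f] restricted to the same line, so the
    induction hypothesis applies to the derivative. *)
Lemma Ck_line V W k (U : set V) (f : V -> W) (x v : V) : open U ->
  Ck k U f -> Ck k [set t : R^o | U (x + t *: v)] (fun t => f (x + t *: v)).
Proof.
move=> oU; have cl : continuous (fun s : R^o => x + s *: v).
  by move=> t; case: (derive_line x v t 0) => /differentiable_continuous.
have oUl : open [set t : R^o | U (x + t *: v)].
  by apply: (open_comp (f := fun s : R^o => x + s *: v)) => // t _; exact: cl.
elim: k f => [|k IH] f /=.
  move=> cf t Ut; apply: (@continuous_comp _ _ _ (fun s : R^o => x + s *: v) f).
    exact: cl.
  exact: cf.
move=> [df Df]; split=> [t Ut|w].
  have [dl _] := derive_line x v t 0.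
  exact: (differentiable_comp dl (df _ Ut)).
apply: Ck_eq (IH _ (Df (w *: v))) => // t Ut.
have [dl Dl] := derive_line x v t w.
rewrite [RHS](@derive_comp _ _ _ f (fun s : R^o => x + s *: v)) ?Dl //.
exact: df.
Qed.

End Calculus.

(** * Bilinear maps, Jacobians, and maps smooth near a point *)

Section LinearMaps.
Context {R : realType}.
Implicit Types (V W : normedModType R).

(* [scale_r] and [qdot_r] live on R^o so as to be bilinear maps of normed
   modules. *)
Definition scale_r {V} (a : R^o) (x : V) : V := a *: x.

Lemma scale_r_is_bilinear V :
  bilinear_for (GRing.Scale.Law.clone _ _ *:%R _)
    (GRing.Scale.Law.clone _ _ *:%R _) (@scale_r V).
Proof.
split=> [u'|u] a x y; rewrite /scale_r /=; first by rewrite scalerDl scalerA.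
by rewrite scalerDr !scalerA mulrC.
Qed.
HB.instance Definition _ V :=
  bilinear_isBilinear.Build R R^o V V _ _ (@scale_r V) (@scale_r_is_bilinear V).

Lemma scale_r_continuous V : continuous (fun p : R^o * V => scale_r p.1 p.2).
Proof. exact: scale_continuous. Qed.

Definition qdot_r {m} (A B : 'M[R]_m) : R^o := qdot A B.

Lemma qdot_r_is_bilinear m :
  bilinear_for (GRing.Scale.Law.clone _ _ *:%R _)
    (GRing.Scale.Law.clone _ _ *:%R _) (@qdot_r m).
Proof.
split=> [u'|u] a x y; rewrite /qdot_r /qdot /=.
  rewrite mulmxDl -scalemxAl mxtraceD mxtraceZ opprD mulrDl -mulrN -mulrA.
  by [].
rewrite mulmxDr -scalemxAr mxtraceD mxtraceZ opprD mulrDl -mulrN -mulrA.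
by [].
Qed.
HB.instance Definition _ m := bilinear_isBilinear.Build R 'M[R]_m 'M[R]_m R^o
  _ _ (@qdot_r m) (@qdot_r_is_bilinear m).

Lemma qdot_r_continuous m :
  continuous (fun p : 'M[R]_m * 'M[R]_m => qdot_r p.1 p.2).
Proof.
(* As a function of the matrix entries [qdot_r] is a polynomial, so continuity follows from that of
   the coordinates. *)
suff h : continuous (fun p : 'M[R]_m * 'M[R]_m =>
    - (\sum_i \sum_j p.1 i j * p.2 j i) / m%:R : R^o).
  rewrite (_ : (fun p => _) = (fun p : 'M[R]_m * 'M[R]_m =>
    - (\sum_i \sum_j p.1 i j * p.2 j i) / m%:R : R^o)) //.
  apply/funext => p; rewrite /qdot_r /qdot /mxtrace.
  by congr (- _ / _); apply: eq_bigr => i _; rewrite mxE.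
move=> p; apply: (@cvgMr_tmp R); apply: (@cvgN R R^o).
apply: cvg_big => [|i _]; first exact: add_continuous.
apply: cvg_big => [|j _]; first exact: add_continuous.
apply: cvgM.
  apply: (@continuous_comp _ _ _ fst (fun A : 'M[R]_m => A i j)).
    exact: cvg_fst.
  exact: coord_continuous.
apply: (@continuous_comp _ _ _ snd (fun A : 'M[R]_m => A j i)).
  exact: cvg_snd.
exact: coord_continuous.
Qed.

Lemma coord_linear {m n} (i : 'I_m) (j : 'I_n) :
  linear (fun A : 'M[R]_(m, n) => A i j : R^o).
Proof. by move=> a x y; rewrite !mxE. Qed.

Definition coord_lin {m n} (i : 'I_m) (j : 'I_n) : {linear 'M[R]_(m, n) -> R^o} :=
  HB.pack (fun A : 'M[R]_(m, n) => A i j : R^o)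
    (GRing.isLinear.Build _ _ _ _ _ (coord_linear i j)).

Lemma jacE m (f : 'cV[R]_m -> 'cV[R]_m) x v :
  differentiable f x -> jac f x *m v = 'D_v f x.
Proof.
move=> df; have dE := deriveE _ df.
rewrite (matrix_sum_delta v) mulmx_sumr.
rewrite (dE (\sum_i _)) linear_sum; apply: eq_bigr => j _.
rewrite big_ord1 -scalemxAr [RHS]linearZ /=; congr (_ *: _).
apply/colP => i; rewrite -dE mxE (bigD1 j) //= big1 ?addr0.
  by rewrite !mxE !eqxx mulr1.
by move=> k kj; rewrite !mxE (negPf kj) mulr0.
Qed.

Lemma jac_comp m (f g : 'cV[R]_m -> 'cV[R]_m) x :
  differentiable f x -> differentiable g (f x) ->
  jac (g \o f) x = jac g (f x) *m jac f x.
Proof.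
move=> df dg; apply/matrixP => i j; rewrite mxE derive_comp // -(jacE _ dg).
rewrite -(jacE _ df) mulmxA -colE mxE.
by [].
Qed.

Lemma jac_near_id m (f : 'cV[R]_m -> 'cV[R]_m) x :
  (\forall y \near x, f y = y) -> jac f x = 1%:M.
Proof.
move=> fid; apply/matrixP => i j; rewrite mxE (@near_eq_derive _ _ _ _ id) //.
by rewrite derive_id !mxE andbT.
Qed.

Lemma smooth_near_differentiable V W (x : V) (f : V -> W) :
  smooth_near x f -> differentiable f x.
Proof. by move=> [U [_ Ux /(_ 1%N)[df _]]]; exact: df. Qed.

Lemma smooth_near_eq V W (x : V) (f g : V -> W) :
  {near x, f =1 g} -> smooth_near x f -> smooth_near x g.
Proof.
rewrite /prop_near1 => fg [U [oU Ux Cf]].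
move: fg; rewrite nbhsE => -[U' [oU' U'x] sU']; exists (U `&` U'); split.
- exact: openI.
- by [].
- move=> k; apply: (Ck_eq (openI oU oU') (f := f)).
    by move=> y [_ /sU'].
  by apply: Ck_subset (Cf k) => y [].
Qed.

Lemma smooth_near_cst V W (x : V) (a : W) : smooth_near x (fun=> a).
Proof. by exists setT; split => // [|k]; [exact: openT|exact: Ck_cst]. Qed.

Lemma smooth_near_linear V W W' (x : V) (l : {linear W -> W'}) (f : V -> W) :
  continuous l -> smooth_near x f -> smooth_near x (l \o f).
Proof.
by move=> cl [U [oU Ux Cf]]; exists U; split => // k; exact: Ck_linear.
Qed.

Lemma smooth_nearD V W (x : V) (f g : V -> W) :
  smooth_near x f -> smooth_near x g -> smooth_near x (fun y => f y + g y).
Proof.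
move=> [U [oU Ux Cf]] [U' [oU' U'x Cg]]; have oUU := openI oU oU'.
exists (U `&` U'); split => // k; apply: CkD => //.
  by apply: Ck_subset (Cf k) => y [].
by apply: Ck_subset (Cg k) => y [].
Qed.

Lemma smooth_near_pair V W W' (x : V) (f : V -> W) (g : V -> W') :
  smooth_near x f -> smooth_near x g -> smooth_near x (fun y => (f y, g y)).
Proof.
move=> [U [oU Ux Cf]] [U' [oU' U'x Cg]]; have oUU := openI oU oU'.
exists (U `&` U'); split => // k; apply: Ck_pair => //.
  by apply: Ck_subset (Cf k) => y [].
by apply: Ck_subset (Cg k) => y [].
Qed.

Lemma smooth_nearZ V W (x : V) (f : V -> R^o) (g : V -> W) :
  smooth_near x f -> smooth_near x g -> smooth_near x (fun y => f y *: g y).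
Proof.
move=> [U [oU Ux Cf]] [U' [oU' U'x Cg]]; have oUU := openI oU oU'.
exists (U `&` U'); split => // k.
apply: (@Ck_bilinear _ V R^o W W k _ (@scale_r W)) => //.
- exact: scale_r_continuous.
- by apply: Ck_subset (Cf k) => y [].
by apply: Ck_subset (Cg k) => y [].
Qed.

Lemma smooth_near_sum V W (I : Type) (r : seq I) (x : V) (f : I -> V -> W) :
  (forall i, smooth_near x (f i)) -> smooth_near x (fun y => \sum_(i <- r) f i y).
Proof.
move=> sf; elim: r => [|i r IH].
  apply: (smooth_near_eq (f := fun=> 0)); last exact: smooth_near_cst.
  by near=> y; rewrite big_nil.
apply: (smooth_near_eq (f := fun y => f i y + \sum_(j <- r) f j y)).
  by near=> y; rewrite big_cons.
by apply: smooth_nearD.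
Unshelve. all: by end_near. Qed.

Lemma smooth_near_line V W (x v : V) (f : V -> W) :
  smooth_near x f -> smooth_near (0 : R^o) (fun t : R^o => f (x + t *: v)).
Proof.
move=> [U [oU Ux Cf]]; exists [set t : R^o | U (x + t *: v)]; split.
- apply: (open_comp (f := fun s : R^o => x + s *: v)) => // t _.
  by case: (derive_line x v t 0) => /differentiable_continuous.
- by rewrite /= scale0r addr0.
- by move=> k; exact: Ck_line.
Qed.

Lemma derive_1 W (f : R^o -> W) (t v : R^o) :
  differentiable f t -> 'D_v f t = v *: 'D_1 f t.
Proof.
move=> df; rewrite !deriveE //; rewrite -linearZ; congr ('d f t _).
by rewrite [RHS]mulr1.
Qed.

Lemma derive1_cos_sin (a b c : R) (t : R) :
  is_derive (t : R^o) 1 (fun t : R^o => a * cos (c * t) + b * sin (c * t) : R^o)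
    (b * c * cos (c * t) + - (a * c) * sin (c * t)).
Proof.
have hc : is_derive (t : R^o) 1 (fun t : R^o => c * t : R^o) c.
  by apply: is_derive_eq; rewrite [LHS]mulr1.
have h1 := is_derive1_comp (is_derive_cos (c * t)) hc.
have h2 := is_derive1_comp (is_derive_sin (c * t)) hc.
have h := is_deriveD (is_deriveZ a h1) (is_deriveZ b h2).
apply: (is_derive_eq h); rewrite /GRing.scale /=; ring.
Qed.

(** The family of combinations of cos(ct) and sin(ct) is stable under differentiation; the direction
    [v] is absorbed into the coefficients. *)
Lemma Ck_cos_sin (a b c : R) k :
  Ck k [set: R^o] (fun t : R^o => a * cos (c * t) + b * sin (c * t) : R^o).
Proof.
elim: k a b => [|k IH] a b /=.
  move=> t _; apply: (differentiable_continuous (V := R^o)).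
  by apply/derivable1_diffP; case: (derive1_cos_sin a b c t).
split=> [t _|v].
  by apply/derivable1_diffP; case: (derive1_cos_sin a b c t).
apply: (Ck_eq openT (f := fun t : R^o =>
  v * (b * c) * cos (c * t) + v * (- (a * c)) * sin (c * t) : R^o)) => //.
move=> t _; have [d1 D1] := derive1_cos_sin a b c t.
rewrite derive_1 ?D1; last exact/derivable1_diffP.
by rewrite [RHS]mulrDr !mulrA.
Qed.

End LinearMaps.

(** * Charts and connection matrices *)

Section Charts.
Context {R : realType} {m : nat} {M : manifold R m}.
Implicit Types (p q : M) (D : connection M).

Lemma image_chart p q : dom p q -> (chart p @` dom p) (chart p q).
Proof. by exists q. Qed.

Lemma chartVK p x : (chart p @` dom p) x -> chart p (chartV p x) = x.
Proof. by move=> [q pq <-]; rewrite chartK. Qed.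

Lemma dom_chartV p x : (chart p @` dom p) x -> dom p (chartV p x).
Proof. by move=> [q pq <-]; rewrite chartK. Qed.

Lemma chartV_chart p : chartV p (chart p p) = p.
Proof. by rewrite chartK //; exact: mem_dom. Qed.

Lemma near_image p q : dom p q -> \forall x \near chart p q, (chart p @` dom p) x.
Proof.
move=> pq; apply: open_nbhs_nbhs; split; [exact: open_image|exact: image_chart].
Qed.

Lemma near_dom p : \forall q \near p, dom p q.
Proof. by apply: open_nbhs_nbhs; split; [exact: open_dom|exact: mem_dom]. Qed.

Lemma near_chartV p q (P : M -> Prop) : dom p q -> (\forall r \near q, P r) ->
  \forall x \near chart p q, P (chartV p x).
Proof.
move=> pq; rewrite -{1}(chartK pq).
exact: (@chartV_continuous _ _ M p (chart p q) (image_chart pq)).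
Qed.

Lemma col_sum_delta k (A : 'M[R]_(m, k)) j :
  \sum_i A i j *: delta_mx i (0 : 'I_1) = A *m delta_mx j 0.
Proof.
rewrite -colE [RHS]matrix_sum_delta; apply: eq_bigr => i _.
by rewrite big_ord1 mxE.
Qed.

(** The two transition maps between the charts at [p] and [q] are mutually inverse near [chart q q],
    so by the chain rule their Jacobians are inverse matrices. *)
Lemma tcoord_unit p q : dom p q -> tcoord p q \in unitmx.
Proof.
move=> pq; have qq := mem_dom q.
have df : differentiable (chart p \o chartV q) (chart q q).
  by apply/smooth_near_differentiable/chart_smooth; exists q.
have fE : (chart p \o chartV q) (chart q q) = chart p q by rewrite /= chartK.
have dg : differentiable (chart q \o chartV p) (chart p q).
  by apply/smooth_near_differentiable/chart_smooth; exists q.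
suff /mulmx1_unit[] : jac (chart q \o chartV p) (chart p q) *m tcoord p q = 1%:M.
  by [].
rewrite -fE -jac_comp ?fE //; apply: jac_near_id.
have := near_chartV qq (open_nbhs_nbhs (conj (open_dom p) pq)).
apply: filterS2 (near_image qq) => x qx px.
by rewrite /= chartK // chartVK.
Qed.

Lemma tcoord_id p : tcoord p p = 1%:M.
Proof.
apply: jac_near_id; apply: filterS (near_image (mem_dom p)) => x px.
by rewrite /= chartVK.
Qed.

Lemma end_coordpp p a : end_coord p p a = a.
Proof. by rewrite /end_coord tcoord_id invmx1 mul1mx mulmx1. Qed.

Lemma ext_vecpp p v : ext_vec p v p = v.
Proof. by rewrite /ext_vec tcoord_id invmx1 mul1mx. Qed.

Lemma end_inpp p (A : M -> 'M[R]_m) : end_in p A (chart p p) = A p.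
Proof. by rewrite /end_in chartV_chart end_coordpp. Qed.

Lemma near_tcoord_unit p :
  \forall x \near chart p p, tcoord p (chartV p x) \in unitmx.
Proof.
apply: filterS (near_image (mem_dom p)) => x px.
exact/tcoord_unit/dom_chartV.
Qed.

Lemma smooth_ext_end p a : smooth_end p (ext_end p a).
Proof.
apply: (smooth_near_eq (f := fun=> a)); last exact: smooth_near_cst.
apply: filterS (near_tcoord_unit p) => x ux.
by rewrite /end_in /end_coord /ext_end !mulmxA mulmxV // mul1mx mulmxK.
Qed.

Lemma derive_ext_end p a v : 'D_v (end_in p (ext_end p a)) (chart p p) = 0.
Proof.
rewrite (@near_eq_derive _ _ _ _ (cst a)) ?derive_cst //.
apply: filterS (near_tcoord_unit p) => x ux.
by rewrite /end_in /end_coord /ext_end !mulmxA mulmxV // mul1mx mulmxK.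
Qed.

Lemma smooth_sum_ext p (r : seq 'I_m) (f : 'I_m -> M -> R) :
  (forall k, smooth_fun p (f k)) ->
  smooth_vec p (fun q => \sum_(k <- r) f k q *: ext_vec p (delta_mx k 0) q).
Proof.
move=> sf.
apply: (smooth_near_eq
  (f := fun x => \sum_(k <- r) fun_in p (f k) x *: (delta_mx k 0 : 'cV_m))).
  apply: filterS (near_tcoord_unit p) => x ux; rewrite /vec_in mulmx_sumr.
  apply: eq_bigr => k _; rewrite /fun_in /= -scalemxAr /ext_vec.
  by rewrite mulmxA mulmxV // mul1mx.
apply: smooth_near_sum => k; apply: smooth_nearZ; first exact: sf.
exact: smooth_near_cst.
Qed.

Lemma smooth_ext_vec p k : smooth_vec p (ext_vec p (delta_mx k 0)).
Proof.
apply: (smooth_near_eq (f := fun=> (delta_mx k 0 : 'cV_m))).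
  2: exact: smooth_near_cst.
apply: filterS (near_tcoord_unit p) => x ux; rewrite /vec_in /ext_vec.
by rewrite mulmxA mulmxV // mul1mx.
Qed.

(** The connection form evaluated on [v]: the matrix Gamma_v of [D] in the coordinate frame of the
    chart at [p]. *)
Definition christoffel D p v : 'M[R]_m :=
  \matrix_(i, j) D p v (ext_vec p (delta_mx j 0)) i 0.

Lemma cov_sum_ext D p v (r : seq 'I_m) (f : 'I_m -> M -> R) :
  (forall k, smooth_fun p (f k)) ->
  D p v (fun q => \sum_(k <- r) f k q *: ext_vec p (delta_mx k 0) q) =
  \sum_(k <- r) (dfun p v (f k) *: delta_mx k 0
                 + f k p *: D p v (ext_vec p (delta_mx k 0))).
Proof.
move=> sf; elim: r => [|k r IH].
  rewrite big_nil; have s0 := smooth_sum_ext [::] sf.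
  (* The derivative of the empty sum vanishes by additivity: the zero field is its own double. *)
  apply: (addrI (D p v
    (fun q => \sum_(k <- [::]) f k q *: ext_vec p (delta_mx k 0) q))).
  rewrite addr0 -covD //; congr (D p v _).
  by apply/funext => q; rewrite !big_nil addr0.
have := cov_leibniz D v (sf k) (smooth_ext_vec p k).
rewrite ext_vecpp big_cons -IH => <-.
rewrite -covD; last 2 first.
- have := smooth_sum_ext [:: k] sf.
  by under [X in smooth_vec _ X -> _]funext => q do rewrite big_seq1.
- exact: smooth_sum_ext.
by congr (D p v _); apply/funext => q; rewrite big_cons.
Qed.

(** Expand the j-th column of [A] in the coordinate frame. In D_v(A e_j) - A D_v e_j,
    differentiating the coefficients gives d_v A, while the derivatives of the frame assemble into
    the commutator with Gamma_v. *)
Lemma cov_endE D p v A : smooth_end p A ->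
  cov_end D p v A = 'D_v (end_in p A) (chart p p)
    + (christoffel D p v *m A p - A p *m christoffel D p v).
Proof.
move=> sA; apply/matrixP => i j; rewrite [LHS]mxE; cbv zeta.
pose f k q := end_coord p q (A q) k j.
have sf k : smooth_fun p (f k).
  apply: (smooth_near_linear (l := coord_lin k j)) sA.
  exact: coord_continuous.
(* The expansion in the frame needs [tcoord p q] invertible, which is known on [dom p]; locality of
   [D] makes this sufficient. *)
have DE : D p v (fun q => A q *m ext_vec p (delta_mx j 0) q) =
    D p v (fun q => \sum_k f k q *: ext_vec p (delta_mx k 0) q).
  apply/esym/cov_local; first exact: smooth_sum_ext.
  apply: filterS (near_dom p) => q /tcoord_unit uq.
  under eq_bigr do rewrite scalemxAr.
  by rewrite -mulmx_sumr col_sum_delta /end_coord !mulmxA mulVmx // mul1mx.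
rewrite DE cov_sum_ext // big_split /= !mxE.
rewrite -addrA; congr (_ + _).
  rewrite summxE (bigD1 i) //= big1 ?addr0 => [|k ki].
    rewrite !mxE !eqxx mulr1 /dfun.
    have cl : continuous (coord_lin i j : 'M[R]_m -> R^o).
      exact: coord_continuous.
    by have [_] := derive_linear v cl (smooth_near_differentiable sA).
  by rewrite !mxE eq_sym (negPf ki) mulr0.
congr (_ - _).
  rewrite summxE; apply: eq_bigr => k _; rewrite !mxE mulrC.
  by rewrite /f end_coordpp.
by apply: eq_bigr => k _; rewrite !mxE.
Qed.

End Charts.

(** * Quaternionic algebra *)

Section Qdot.
Context {R : realType} {m : nat}.
Implicit Types A B C J T : 'M[R]_m.

Lemma qdotC A B : qdot A B = qdot B A.
Proof. by rewrite /qdot mxtrace_mulC. Qed.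

Lemma qdotDl A B C : qdot (A + B) C = qdot A C + qdot B C.
Proof. by rewrite /qdot mulmxDl mxtraceD opprD mulrDl. Qed.

Lemma qdotZl a A B : qdot (a *: A) B = a * qdot A B.
Proof. by rewrite /qdot -scalemxAl mxtraceZ -mulrN mulrA. Qed.

Lemma qdotNl A B : qdot (- A) B = - qdot A B.
Proof. by rewrite -scaleN1r qdotZl mulN1r. Qed.

Lemma qdot0l A : qdot 0 A = 0.
Proof. by rewrite /qdot mul0mx linear0 oppr0 mul0r. Qed.

Lemma qdotDr A B C : qdot A (B + C) = qdot A B + qdot A C.
Proof. by rewrite qdotC qdotDl !(qdotC _ A). Qed.

Lemma qdotZr a A B : qdot A (a *: B) = a * qdot A B.
Proof. by rewrite qdotC qdotZl qdotC. Qed.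

Lemma qdot_conj T A B : T \in unitmx ->
  qdot (T *m A *m invmx T) (T *m B *m invmx T) = qdot A B.
Proof.
move=> uT; rewrite /qdot; congr (- _ / _).
rewrite mxtrace_mulC !mulmxA mulmxKV // mxtrace_mulC !mulmxA mulVmx //.
by rewrite mul1mx mxtrace_mulC.
Qed.

(** Cyclicity of the trace. It makes the connection term [Gamma_v, J] orthogonal to [J]. *)
Lemma qdot_commutator A J : qdot (A *m J - J *m A) J = 0.
Proof.
rewrite /qdot mulmxBl raddfB /= -[J *m A *m J]mulmxA [X in _ - X]mxtrace_mulC.
by rewrite subrr oppr0 mul0r.
Qed.

Lemma Theta_projD J A B : Theta_proj J (A + B) = Theta_proj J A + Theta_proj J B.
Proof. by rewrite /Theta_proj qdotDl scalerDl opprD addrACA. Qed.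

Lemma Theta_projZ J a A : Theta_proj J (a *: A) = a *: Theta_proj J A.
Proof. by rewrite /Theta_proj qdotZl scalerBr scalerA. Qed.

Lemma Theta_proj_id J A : qdot A J = 0 -> Theta_proj J A = A.
Proof. by rewrite /Theta_proj => ->; rewrite scale0r subr0. Qed.

Lemma Theta_proj_self J : qdot J J = 1 -> Theta_proj J J = 0.
Proof. by rewrite /Theta_proj => ->; rewrite scale1r subrr. Qed.

End Qdot.

(** * Coordinates in an admissible basis *)

Section Quaternions.
Context {R : realType} {m : nat}.
Variables (Qp : set 'M[R]_m) (J1 J2 J3 : 'M[R]_m).
Hypotheses (m_gt0 : (0 < m)%N) (admJ : admissible Qp J1 J2 J3).

Definition comb (x1 x2 x3 : R) := x1 *: J1 + x2 *: J2 + x3 *: J3.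

Lemma combP A : Qp A <-> exists x1 x2 x3, A = comb x1 x2 x3.
Proof. by have [_ _ _ _ ->] := admJ. Qed.

Lemma comb_mem x1 x2 x3 : Qp (comb x1 x2 x3).
Proof. by apply/combP; exists x1, x2, x3. Qed.

Lemma comb_lin a x1 x2 x3 y1 y2 y3 :
  a *: comb x1 x2 x3 + comb y1 y2 y3
  = comb (a * x1 + y1) (a * x2 + y2) (a * x3 + y3).
Proof. by rewrite /comb !scalerDr !scalerA !scalerDl addrACA [X in X + _]addrACA. Qed.

Lemma mem_lin a A B : Qp A -> Qp B -> Qp (a *: A + B).
Proof.
move=> /combP[x1 [x2 [x3 ->]]] /combP[y1 [y2 [y3 ->]]].
by rewrite comb_lin; exact: comb_mem.
Qed.

Lemma mem_frame : [/\ Qp J1, Qp J2 & Qp J3].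
Proof.
split; apply/combP; [exists 1, 0, 0|exists 0, 1, 0|exists 0, 0, 1];
by rewrite /comb !scale0r scale1r ?addr0 ?add0r.
Qed.

Lemma qdot_comb x1 x2 x3 y1 y2 y3 :
  qdot (comb x1 x2 x3) (comb y1 y2 y3) = x1 * y1 + x2 * y2 + x3 * y3.
Proof.
have [[q1 q2 q3] [q12 q23 q13]] := admissible_orthonormal m_gt0 admJ.
rewrite /comb !(qdotDl, qdotDr, qdotZl, qdotZr) q1 q2 q3 q12 q23 q13.
by rewrite (qdotC J2 J1) (qdotC J3 J1) (qdotC J3 J2) q12 q23 q13; ring.
Qed.

Lemma mem_combE A : Qp A -> A = comb (qdot A J1) (qdot A J2) (qdot A J3).
Proof.
move=> /combP[x1 [x2 [x3 ->]]].
have [E1 E2 E3] : [/\ J1 = comb 1 0 0, J2 = comb 0 1 0 & J3 = comb 0 0 1].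
  by split; rewrite /comb !scale0r scale1r ?addr0 ?add0r.
by rewrite E1 E2 E3 !qdot_comb; congr comb; ring.
Qed.

Lemma mem_eq A B : Qp A -> Qp B -> (forall C, Qp C -> qdot A C = qdot B C) -> A = B.
Proof.
move=> QA QB AB; have [? ? ?] := mem_frame.
by rewrite (mem_combE QA) (mem_combE QB) !AB.
Qed.

Lemma frame_mul :
  [/\ J1 *m J1 = - 1%:M, J2 *m J2 = - 1%:M & J3 *m J3 = - 1%:M] /\
  [/\ J1 *m J2 = J3, J2 *m J3 = J1 & J3 *m J1 = J2] /\
  [/\ J2 *m J1 = - J3, J3 *m J2 = - J1 & J1 *m J3 = - J2].
Proof.
have [J11 J22 J12 J21 _] := admJ.
have J23 : J2 *m J3 = J1.
  by rewrite -[J3]opprK -J21 mulmxN mulmxA J22 mulNmx mul1mx opprK.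
have J31 : J3 *m J1 = J2.
  by rewrite -[J3]opprK -J21 mulNmx -mulmxA J11 mulmxN mulmx1 opprK.
split; split => //; first by rewrite -{1}J12 -mulmxA J23.
split => //; first by rewrite -J12 -mulmxA J22 mulmxN mulmx1.
by rewrite -J12 mulmxA J11 mulNmx mul1mx.
Qed.

(** This is the product of imaginary quaternions, minus the dot product plus the cross product. *)
Lemma comb_mul x1 x2 x3 y1 y2 y3 :
  comb x1 x2 x3 *m comb y1 y2 y3 = (- (x1 * y1 + x2 * y2 + x3 * y3))%:M
  + comb (x2 * y3 - x3 * y2) (x3 * y1 - x1 * y3) (x1 * y2 - x2 * y1).
Proof.
have [[J11 J22 J33] [[J12 J23 J31] [J21 J32 J13]]] := frame_mul.
rewrite /comb !(mulmxDl, mulmxDr) -!scalemxAl -!scalemxAr.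
rewrite J11 J22 J33 J12 J23 J31 J21 J32 J13.
apply/matrixP => i j; rewrite !mxE.
ring.
Qed.

End Quaternions.

Local Notation contraction := Defs.contraction.

(** * The splitting of T^*M (x) Q at a point *)

Section PenroseAlgebra.
Context {R : realType} {m : nat}.
Variables (Qp : set 'M[R]_m) (J1 J2 J3 : 'M[R]_m).
Hypotheses (m_gt0 : (0 < m)%N) (admJ : admissible Qp J1 J2 J3).
Implicit Types (phi psi : 'cV[R]_m -> 'M[R]_m) (alpha : 'rV[R]_m).

(* A description of [EH] that does not refer to an admissible basis. *)
Definition paired alpha phi := forall v, Qp (phi v) /\
  forall B, Qp B -> qdot (phi v) B = (alpha *m B *m v) 0 0.

Lemma row_combE K1 K2 K3 alpha (x1 x2 x3 : R) (v : 'cV[R]_m) :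
  (alpha *m comb K1 K2 K3 x1 x2 x3 *m v) 0 0 =
  x1 * (alpha *m K1 *m v) 0 0 + x2 * (alpha *m K2 *m v) 0 0
  + x3 * (alpha *m K3 *m v) 0 0.
Proof.
rewrite /comb !mulmxDr -!scalemxAr !mulmxDl -!scalemxAl.
move: (alpha *m K1 *m v) (alpha *m K2 *m v) (alpha *m K3 *m v) => a1 a2 a3.
by rewrite !mxE.
Qed.

(** Coefficients in an orthonormal basis are inner products with its members, and the pairing
    condition is linear in [B]. An element of E^* (x) H written in one admissible basis therefore
    has the same form, with the same [alpha], in [J1, J2, J3]. *)
Lemma EH_pairedP phi : EH Qp phi <-> exists alpha, paired alpha phi.
Proof.
split=> [[K1 [K2 [K3 [admK [alpha phiE]]]]]|[alpha pphi]].
  exists alpha => v; rewrite phiE; split.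
    exact: (comb_mem admK).
  move=> B /(combP admK)[x1 [x2 [x3 ->]]].
  by rewrite (qdot_comb m_gt0 admK) row_combE; ring.
exists J1, J2, J3; split => //; exists alpha => v.
have [Qv pv] := pphi v; have [? ? ?] := mem_frame admJ.
by rewrite {1}(mem_combE m_gt0 admJ Qv) !pv.
Qed.

Definition EH_elt alpha (v : 'cV[R]_m) : 'M[R]_m :=
  comb J1 J2 J3 ((alpha *m J1 *m v) 0 0) ((alpha *m J2 *m v) 0 0)
    ((alpha *m J3 *m v) 0 0).

Lemma EH_elt_EH alpha : EH Qp (EH_elt alpha).
Proof. by exists J1, J2, J3; split => //; exists alpha. Qed.

Lemma pairedE alpha phi : paired alpha phi -> phi = EH_elt alpha.
Proof.
move=> pphi; apply/funext => v.
have [Qv pv] := pphi v; have [? ? ?] := mem_frame admJ.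
by rewrite {1}(mem_combE m_gt0 admJ Qv) !pv.
Qed.

(** Each of the three summands contributes alpha o J_i o J_i = -alpha. Hence the contraction is
    injective on E^* (x) H and determines [alpha]. *)
Lemma contraction_EH_elt alpha : contraction (EH_elt alpha) = - 3 *: alpha.
Proof.
have [[J11 J22 J33] _] := frame_mul admJ.
have E (K : 'M[R]_m) : K *m K = - 1%:M ->
    \sum_i (alpha *m K *m delta_mx i (0 : 'I_1)) 0 0 *: row i K = - alpha.
  move=> KK; transitivity (alpha *m K *m K).
    by rewrite [RHS]mulmx_sum_row; apply: eq_bigr => i _; rewrite -colE mxE.
  by rewrite -mulmxA KK mulmxN mulmx1.
rewrite /contraction /EH_elt /comb.
under eq_bigr do rewrite !linearD /= !linearZ /=.
rewrite !big_split /= !E //.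
by apply/rowP => i; rewrite !mxE; ring.
Qed.

Lemma contractionB phi psi :
  contraction (fun v => phi v - psi v) = contraction phi - contraction psi.
Proof.
by rewrite /contraction -sumrB; apply: eq_bigr => i _; rewrite linearB.
Qed.

Lemma EH_elt_lin alpha a u v :
  EH_elt alpha (a *: u + v) = a *: EH_elt alpha u + EH_elt alpha v.
Proof.
rewrite /EH_elt comb_lin.
by congr comb; rewrite mulmxDr -scalemxAr [LHS]mxE [X in X + _]mxE.
Qed.

(** The decomposition exists, by subtracting the element of E^* (x) H with the same contraction, and
    for [phi] in E^* (x) H the first component must be 0 since the contraction is injective on E^*
    (x) H. *)
Lemma ES3H_proj0P phi : cotensor Qp phi ->
  (forall v, ES3H_proj Qp phi v = 0) <-> EH Qp phi.
Proof.
move=> [lphi Qphi]; split=> [phi0|/EH_pairedP[alpha pphi] v].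
  (* The factor -1/3 inverts the factor -3 of [contraction_EH_elt], so [phi - chi] has zero
     contraction. *)
  pose chi := EH_elt (- 3^-1 *: contraction phi).
  have Qchi v : Qp (chi v) by exact: comb_mem admJ _ _ _.
  suff : [set psi | ES3H Qp psi /\ EH Qp (fun v => phi v - psi v)]
      (fun v => phi v - chi v).
    (* The set being inhabited, [xget] returns a member of it; as this member is 0, membership says
       that [phi] itself lies in [EH]. *)
    move=> /(xgetI (fun=> 0)); rewrite -/(ES3H_proj Qp phi) => -[_].
    by under [X in EH _ X -> _]funext => v do rewrite phi0 subr0.
  split; first split; first split.
  - by move=> a u v; rewrite lphi /chi EH_elt_lin scalerBr opprD addrACA.
  - move=> v; rewrite addrC -scaleN1r; exact: (mem_lin admJ).
  - rewrite contractionB contraction_EH_elt scalerA.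
    by rewrite (_ : - 3 * - 3^-1 = 1) ?scale1r ?subrr // mulrNN divff.
  - under [X in EH _ X]funext => v do rewrite subKr.
    exact: EH_elt_EH.
(* On an empty set [xget] would return its default 0, which is the desired value. *)
rewrite /ES3H_proj; case: xgetP => [psi _|//].
move=> [[[_ Qpsi] cpsi] /EH_pairedP[beta pbeta]].
(* As [psi] has zero contraction, [phi] and [phi - psi] have the same one, hence the same covector.
   They then pair equally with all of Q, so [psi] pairs to zero. *)
have ab : alpha = beta.
  have := contractionB phi psi; rewrite (pairedE pbeta) {1}(pairedE pphi).
  rewrite !contraction_EH_elt cpsi subr0 => /scalerI e.
  by rewrite e // oppr_eq0 pnatr_eq0.
have [Q0 q0] := pbeta v; have [_ qphi] := pphi v.
apply: (mem_eq m_gt0 admJ (Qpsi v)).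
  by have := comb_mem admJ 0 0 0; rewrite /comb !scale0r !addr0.
move=> C QC; have := q0 _ QC; rewrite -ab -qphi // qdotDl qdotNl.
by move=> e; rewrite qdot0l; lra.
Qed.

Lemma linear_functional (g : 'cV[R]_m -> R) :
  (forall a u v, g (a *: u + v) = a * g u + g v) ->
  exists beta : 'rV[R]_m, forall v, g v = (beta *m v) 0 0.
Proof.
move=> lg; have g0 : g 0 = 0.
  by have := lg 1 0 0; rewrite scale1r addr0; lra.
exists (\row_j g (delta_mx j 0)) => v.
rewrite mxE {1}(matrix_sum_delta v).
elim/big_rec2: _ => [//|j y1 y2 _ <-].
by rewrite big_ord1 lg !mxE mulrC.
Qed.

(** Since X o X = -1, removing the X-component of c cancels the scalar part of X o c and leaves the
    cross product of x and c. In coordinates the sum is a - <a, x> x + x cross c. *)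
Lemma rotation_comb x1 x2 x3 a1 a2 a3 c1 c2 c3 :
  x1 * x1 + x2 * x2 + x3 * x3 = 1 ->
  let X := comb J1 J2 J3 x1 x2 x3 in
  let s := a1 * x1 + a2 * x2 + a3 * x3 in
  Theta_proj X (comb J1 J2 J3 a1 a2 a3)
    + X *m Theta_proj X (comb J1 J2 J3 c1 c2 c3)
  = comb J1 J2 J3 (a1 - s * x1 + (x2 * c3 - x3 * c2))
      (a2 - s * x2 + (x3 * c1 - x1 * c3)) (a3 - s * x3 + (x1 * c2 - x2 * c1)).
Proof.
move=> xx X s; have XX : X *m X = - 1%:M.
  rewrite (comb_mul admJ) xx raddfN /= (_ : comb _ _ _ _ _ _ = 0) ?addr0 //.
  by rewrite /comb ![_ * x1]mulrC [x3 * x2]mulrC !subrr !scale0r !addr0.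
rewrite /Theta_proj !(qdot_comb m_gt0 admJ) -/s mulmxBr -scalemxAr XX.
rewrite (comb_mul admJ) scalerN opprK scalemx1 raddfN /=.
rewrite (_ : x1 * c1 + x2 * c2 + x3 * c3 = c1 * x1 + c2 * x2 + c3 * x3); last ring.
rewrite [X in _ + X = _]addrAC addNr add0r -scaleNr.
rewrite [comb _ _ _ a1 a2 a3 + _]addrC comb_lin.
rewrite -[X in X + _]scale1r comb_lin.
by congr comb; ring.
Qed.

Lemma comb0P x1 x2 x3 : comb J1 J2 J3 x1 x2 x3 = 0 -> [/\ x1 = 0, x2 = 0 & x3 = 0].
Proof.
move=> c0; have q y1 y2 y3 := qdot_comb m_gt0 admJ x1 x2 x3 y1 y2 y3.
have z y1 y2 y3 : x1 * y1 + x2 * y2 + x3 * y3 = 0.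
  by rewrite -q c0 qdot0l.
by have := z 1 0 0; have := z 0 1 0; have := z 0 0 1; split; lra.
Qed.

(** With b_i the coordinates of [phi], the condition at [J1] and [J2] expresses b_2 and b_3 through
    b_1, which produces [alpha]. Conversely, for [phi] in E^* (x) H the expression is a multiple of
    1 - |x|^2. *)
Lemma EH_rotationP phi : cotensor Qp phi ->
  (forall J, Qp J -> qdot J J = 1 -> forall v,
     Theta_proj J (phi v) + J *m Theta_proj J (phi (J *m v)) = 0) <->
  EH Qp phi.
Proof.
have [[J11 J22 J33] [[J12 J23 J31] [J21 J32 J13]]] := frame_mul admJ.
move=> [lphi Qphi]; split=> [rot|/EH_pairedP[alpha pphi] J /(combP admJ)].
  have qlin K : exists beta : 'rV[R]_m, forall v, qdot (phi v) K = (beta *m v) 0 0.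
    by apply: linear_functional => a u v; rewrite lphi qdotDl qdotZl.
  have [b1 b1E] := qlin J1; have [b2 b2E] := qlin J2; have [b3 b3E] := qlin J3.
  have phiE v : phi v =
      comb J1 J2 J3 ((b1 *m v) 0 0) ((b2 *m v) 0 0) ((b3 *m v) 0 0).
    by rewrite -b1E -b2E -b3E; exact: mem_combE m_gt0 admJ _ (Qphi v).
  have E1 : J1 = comb J1 J2 J3 1 0 0 by rewrite /comb !scale0r scale1r !addr0.
  have E2 : J2 = comb J1 J2 J3 0 1 0.
    by rewrite /comb !scale0r scale1r addr0 add0r.
  have rotv (v : 'cV[R]_m) x1 x2 x3 X : X = comb J1 J2 J3 x1 x2 x3 ->
      x1 * x1 + x2 * x2 + x3 * x3 = 1 ->
      let a (b : 'rV[R]_m) := (b *m v) 0 0 in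
      let c (b : 'rV[R]_m) := (b *m (X *m v)) 0 0 in
      let s := a b1 * x1 + a b2 * x2 + a b3 * x3 in
      [/\ a b1 - s * x1 + (x2 * c b3 - x3 * c b2) = 0,
          a b2 - s * x2 + (x3 * c b1 - x1 * c b3) = 0
        & a b3 - s * x3 + (x1 * c b2 - x2 * c b1) = 0].
    move=> XE xx a c s; apply: comb0P; rewrite -rotation_comb // -XE -!phiE.
    by apply: rot; rewrite XE ?(qdot_comb m_gt0 admJ) //; exact: comb_mem.
  (* The condition at x = (1, 0, 0): its first equation is trivial and the other two link b_2 and
     b_3. *)
  have E3 (v : 'cV[R]_m) : (b3 *m v) 0 0 = - (b2 *m (J1 *m v)) 0 0
      /\ (b2 *m v) 0 0 = (b3 *m (J1 *m v)) 0 0.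
    have xx : (1 : R) * 1 + 0 * 0 + 0 * 0 = 1 by ring.
    have /= [e1 e2 e3] := rotv v _ _ _ _ E1 xx; split; lra.
  have E4 (v : 'cV[R]_m) : (b3 *m v) 0 0 = (b1 *m (J2 *m v)) 0 0.
    have xx : (0 : R) * 0 + 1 * 1 + 0 * 0 = 1 by ring.
    have /= [e1 e2 e3] := rotv v _ _ _ _ E2 xx; lra.
  (* The requirement alpha o J1 = b_1 forces alpha = -b_1 o J1, because J1 o J1 = -1. *)
  exists J1, J2, J3; split => //; exists (- b1 *m J1) => v.
  have e2 : (b2 *m v) 0 0 = (- (b1 *m (J3 *m v))) 0 0.
    by rewrite (E3 v).2 E4 (mulmxA J2) J21 mulNmx mulmxN.
  rewrite -!(mulmxA (- b1)) J11 J12 J13.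
  by rewrite !mulNmx mul1mx !mulmxN !opprK -E4 -e2 phiE.
move=> [x1 [x2 [x3 ->]]]; rewrite (qdot_comb m_gt0 admJ) => xx v.
rewrite (pairedE pphi) /EH_elt rotation_comb //.
set X := comb J1 J2 J3 x1 x2 x3.
have cE (K : 'M[R]_m) a0 y1 y2 y3 : K *m X = a0%:M + comb J1 J2 J3 y1 y2 y3 ->
    (alpha *m K *m (X *m v)) 0 0 = a0 * (alpha *m v) 0 0
      + (y1 * (alpha *m J1 *m v) 0 0 + y2 * (alpha *m J2 *m v) 0 0
         + y3 * (alpha *m J3 *m v) 0 0).
  move=> KX; rewrite mulmxA -(mulmxA alpha) KX mulmxDr mulmxDl [LHS]mxE row_combE.
  by rewrite mul_mx_scalar -scalemxAl; congr (_ + _); rewrite mxE.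
have [E1 E2 E3] : [/\ J1 = comb J1 J2 J3 1 0 0, J2 = comb J1 J2 J3 0 1 0
    & J3 = comb J1 J2 J3 0 0 1].
  by split; rewrite /comb !scale0r scale1r ?addr0 ?add0r.
(* These products re-expand alpha o J_i o X in terms of alpha and the alpha o J_k. *)
have M1 : J1 *m X = (- x1)%:M + comb J1 J2 J3 0 (- x3) x2.
  rewrite {1}E1 (comb_mul admJ); congr (_%:M + comb _ _ _ _ _ _); ring.
have M2 : J2 *m X = (- x2)%:M + comb J1 J2 J3 x3 0 (- x1).
  rewrite {1}E2 (comb_mul admJ); congr (_%:M + comb _ _ _ _ _ _); ring.
have M3 : J3 *m X = (- x3)%:M + comb J1 J2 J3 (- x2) x1 0.
  rewrite {1}E3 (comb_mul admJ); congr (_%:M + comb _ _ _ _ _ _); ring.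
rewrite (cE _ _ _ _ _ M1) (cE _ _ _ _ _ M2) (cE _ _ _ _ _ M3).
move: ((alpha *m v) 0 0) ((alpha *m J1 *m v) 0 0) ((alpha *m J2 *m v) 0 0)
  ((alpha *m J3 *m v) 0 0) => a0 a1 a2 a3.
rewrite (_ : comb _ _ _ _ _ _ = comb J1 J2 J3 (0 : R) 0 0).
  by rewrite /comb !scale0r !addr0.
(* Every coordinate has the factor 1 - |x|^2, which vanishes because [X] is a unit vector. *)
congr comb.
- transitivity ((1 - (x1 * x1 + x2 * x2 + x3 * x3)) * a1); first ring.
  by rewrite xx subrr mul0r.
- transitivity ((1 - (x1 * x1 + x2 * x2 + x3 * x3)) * a2); first ring.
  by rewrite xx subrr mul0r.
- transitivity ((1 - (x1 * x1 + x2 * x2 + x3 * x3)) * a3); first ring.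
  by rewrite xx subrr mul0r.
Qed.

End PenroseAlgebra.

(** * Curves in the twistor space *)

Section CovariantDerivative.
Context {R : realType} {m : nat} {M : manifold R m}.
Implicit Types (p : M) (D : connection M) (A B : M -> 'M[R]_m).

Lemma christoffel_lin D p a v w :
  christoffel D p (a *: v + w) = a *: christoffel D p v + christoffel D p w.
Proof.
apply/matrixP => i j; rewrite !mxE cov_linear ?mxE //; exact: smooth_ext_vec.
Qed.

Lemma cov_end_lin D p A a v w : smooth_end p A ->
  cov_end D p (a *: v + w) A = a *: cov_end D p v A + cov_end D p w A.
Proof.
move=> sA; have dA := smooth_near_differentiable sA.
rewrite !cov_endE // christoffel_lin (deriveE _ dA) linearP -!(deriveE _ dA).
rewrite mulmxDl mulmxDr -scalemxAl -scalemxAr.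
by rewrite opprD [X in _ + X]addrACA [LHS]addrACA -scalerBr -scalerDr.
Qed.

Lemma cov_ext_endE D p v a :
  cov_end D p v (ext_end p a) = christoffel D p v *m a - a *m christoffel D p v.
Proof.
rewrite cov_endE ?derive_ext_end ?add0r; last exact: smooth_ext_end.
by rewrite /ext_end tcoord_id invmx1 mul1mx mulmx1.
Qed.

(** Separates the derivative of the coordinates from a term depending only on [A p]. The definitions
    of [pull_cov] and [vert] are split in the same way, so only coordinate derivatives remain to be
    compared along curves. *)
Lemma cov_end_ext_end D p v A : smooth_end p A ->
  cov_end D p v A = 'D_v (end_in p A) (chart p p) + cov_end D p v (ext_end p (A p)).
Proof. by move=> sA; rewrite cov_ext_endE cov_endE. Qed.

Lemma cov_ext_end_lin D p v a (x y : 'M[R]_m) :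
  cov_end D p v (ext_end p (a *: x + y))
  = a *: cov_end D p v (ext_end p x) + cov_end D p v (ext_end p y).
Proof.
rewrite !cov_ext_endE mulmxDr mulmxDl -scalemxAl -scalemxAr scalerBr opprD.
by rewrite addrACA.
Qed.

Lemma cov_ext_end_Theta D p v (J a : 'M[R]_m) :
  cov_end D p v (ext_end p (Theta_proj J a))
  = cov_end D p v (ext_end p a) - qdot a J *: cov_end D p v (ext_end p J).
Proof. by rewrite /Theta_proj addrC -scaleNr cov_ext_end_lin addrC scaleNr. Qed.

Lemma qdot_cov_ext_end D p v (a : 'M[R]_m) :
  qdot (cov_end D p v (ext_end p a)) a = 0.
Proof. by rewrite cov_ext_endE qdot_commutator. Qed.

Lemma derive_qdot (V : normedModType R) (f g : V -> 'M[R]_m) x v :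
  differentiable f x -> differentiable g x ->
  differentiable (fun y => qdot (f y) (g y) : R^o) x /\
  'D_v (fun y => qdot (f y) (g y) : R^o) x
    = qdot (f x) ('D_v g x) + qdot ('D_v f x) (g x).
Proof.
exact: (@derive_bilinear R V _ _ _ (@qdot_r R m) f g x v (@qdot_r_continuous R m)).
Qed.

Lemma derive_scale (V W : normedModType R) (f : V -> R^o) (g : V -> W) x v :
  differentiable f x -> differentiable g x ->
  differentiable (fun y => f y *: g y) x /\
  'D_v (fun y => f y *: g y) x = f x *: 'D_v g x + 'D_v f x *: g x.
Proof.
exact: (@derive_bilinear R V _ _ _ (@scale_r R W) f g x v (@scale_r_continuous R W)).
Qed.

(** The derivative of the coefficient <f, g> only contributes a multiple of [gy]; it is left as an
    unspecified [r] because projecting orthogonally to J kills it later. *)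
Lemma derive_Theta_proj (V : normedModType R) (f g : V -> 'M[R]_m) y v fy gy f' g' :
  differentiable f y -> differentiable g y -> f y = fy -> g y = gy ->
  'D_v f y = f' -> 'D_v g y = g' ->
  exists r, 'D_v (fun z => Theta_proj (g z) (f z)) y
  = f' - qdot fy gy *: g' + r *: gy.
Proof.
move=> df dg <- <- <- <-.
have [dq _] := derive_qdot v df dg.
have [ds Ds] := derive_scale v dq dg.
pose r := 'D_v (fun z => qdot (f z) (g z) : R^o) y; exists (- r).
transitivity ('D_v f y - 'D_v (fun z => qdot (f z) (g z) *: g z) y).
  by apply: deriveB; exact: diff_derivable.
apply: etrans (congr1 (fun Z => 'D_v f y - Z) Ds) _; rewrite -/r.
move: ('D_v f y) ('D_v g y) r => X Y r.
by rewrite scaleNr opprD addrA.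
Qed.

Lemma qdot_end_coord (p q : M) (a b : 'M[R]_m) : tcoord p q \in unitmx ->
  qdot (end_coord p q a) (end_coord p q b) = qdot a b.
Proof. exact: qdot_conj. Qed.

Lemma end_coord_Theta (p q : M) (J a : 'M[R]_m) : tcoord p q \in unitmx ->
  end_coord p q (Theta_proj J a) = Theta_proj (end_coord p q J) (end_coord p q a).
Proof.
move=> uT; rewrite /Theta_proj qdot_end_coord // /end_coord.
by rewrite mulmxBr mulmxBl -scalemxAr -scalemxAl.
Qed.

(** Differentiating <B, B> = 1 shows that the coordinate derivative is orthogonal to [B p], and the
    connection term is a commutator with [B p]. *)
Lemma qdot_cov_unit D p v B : smooth_end p B ->
  (\forall q \near p, qdot (B q) (B q) = 1) -> qdot (cov_end D p v B) (B p) = 0.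
Proof.
move=> sB B1; rewrite cov_end_ext_end // qdotDl qdot_cov_ext_end addr0.
have dB := smooth_near_differentiable sB.
have [_] := derive_qdot v dB dB.
rewrite (@near_eq_derive _ _ R^o _ (cst (1 : R^o))).
  rewrite derive_cst end_inpp qdotC => e; lra.
have := near_chartV (mem_dom p) B1.
apply: filterS2 (near_tcoord_unit p) => x ux.
by rewrite /end_in /end_coord qdot_conj.
Qed.

End CovariantDerivative.

(** * Derivatives of distinguished sections along curves in Z *)

Section TwistorCurves.
Context {R : realType} {m : nat} {M : manifold R m}.
Variables (Q : M -> set 'M[R]_m) (D : connection M).
Implicit Types (p : M) (J : 'M[R]_m) (A B : M -> 'M[R]_m).

Definition base_path p (c : R -> M * 'M[R]_m) (t : R^o) : 'cV[R]_m :=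
  (zcoord p (c t)).1.

Definition fiber_path p (c : R -> M * 'M[R]_m) (t : R^o) : 'M[R]_m :=
  (zcoord p (c t)).2.

Section Curve.
Variables (p : M) (J : 'M[R]_m) (U : 'cV[R]_m * 'M[R]_m) (c : R -> M * 'M[R]_m).
Hypothesis cU : zcurve Q p J U c.

Local Notation x := (base_path p c).
Local Notation a := (fiber_path p c).

Lemma zcurve_derive : (differentiable x 0 /\ 'D_1 x 0 = U.1) /\
  (differentiable a 0 /\ 'D_1 a 0 = U.2).
Proof.
have [_ _ sc Uc] := cU; have dc := smooth_near_differentiable sc.
rewrite derive1E in Uc; rewrite -Uc.
have c1 : continuous (fst : {linear ('cV[R]_m * 'M[R]_m)%type -> 'cV[R]_m}).
  by move=> z; exact: cvg_fst.
have c2 : continuous (snd : {linear ('cV[R]_m * 'M[R]_m)%type -> 'M[R]_m}).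
  by move=> z; exact: cvg_snd.
split; first exact: (derive_linear _ c1 dc).
exact: (derive_linear _ c2 dc).
Qed.

Lemma zcurve0 : x 0 = chart p p /\ a 0 = J.
Proof. by have [c0 _ _ _] := cU; rewrite /base_path /fiber_path c0 /= end_coordpp. Qed.

Lemma zcurve_near : \forall t \near (0 : R), [/\ chartV p (x t) = (c t).1,
  tcoord p (c t).1 \in unitmx & twistor Q (c t)].
Proof.
have [_ nc _ _] := cU; apply: filterS nc => t [pt Qt].
by split => //; [exact: chartK|exact: tcoord_unit].
Qed.

Lemma zcurve_end A : smooth_end p A ->
  [/\ differentiable (fun t => end_in p A (x t)) 0,
      'D_1 (fun t => end_in p A (x t)) 0 = 'D_(U.1) (end_in p A) (chart p p)
    & end_in p A (x 0) = A p].
Proof.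
move=> sA; have [x0 _] := zcurve0; have [[dx Dx] _] := zcurve_derive.
have dA : differentiable (end_in p A) (x 0).
  by rewrite x0; exact: smooth_near_differentiable.
split; first exact: (differentiable_comp dx dA).
  by rewrite -x0 -Dx; exact: (derive_comp _ dx dA).
by rewrite x0 end_inpp.
Qed.

(** The chain rule and [derive_Theta_proj] give d_v A - <A, J> U.2 up to a multiple of [J]. The
    zeroth-order terms of [pull_cov] complete d_v A to D_v A and U.2 to the vertical part of [U]. *)
Lemma zcurve_distinguished A : smooth_end p A -> exists r,
  derive1 (fun t => end_coord p (c t).1 (distinguished A (c t))) 0
    + cov_end D p U.1 (ext_end p (distinguished A (p, J)))
  = cov_end D p U.1 A - qdot (A p) J *: vert D p J U + r *: J.
Proof.
move=> sA; have [dA DA A0] := zcurve_end sA.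
have [_ a0] := zcurve0; have [_ [da Da]] := zcurve_derive.
have [r rE] := derive_Theta_proj dA da A0 a0 DA Da; exists r.
(* Conjugation by [tcoord] preserves [qdot], hence commutes with the projection, so along the curve
   everything can be written in the chart at [p]. *)
rewrite derive1E (@near_eq_derive _ _ _ _
    (fun t : R^o => Theta_proj (a t) (end_in p A (x t)))); last first.
  apply: filterS zcurve_near => t [xt ut _].
  by rewrite /end_in xt; exact: end_coord_Theta.
apply: etrans (congr2 +%R rE (cov_ext_end_Theta D p U.1 J (A p))) _.
rewrite (cov_end_ext_end _ _ sA) /vert.
move: (cov_end D p _ (ext_end p J)) (cov_end D p _ _) ('D_(U.1) _ _) => X Y Z.
move: (qdot _ _) U.2 => q V.
by apply/matrixP => i j; rewrite !mxE; ring.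
Qed.

End Curve.

(** The formula holds for whichever curve [xget] selects, only [r] being tied to that choice;
    tangency of [U] excludes the default value. *)
Lemma pull_cov_distinguished p J U A : tangentZ Q p J U -> smooth_end p A ->
  exists r, pull_cov Q D p J U (distinguished A)
  = cov_end D p U.1 A - qdot (A p) J *: vert D p J U + r *: J.
Proof.
move=> [c0 c0U] sA; rewrite /pull_cov.
case: xgetP => [W -> [c cU ->]|]; first exact: zcurve_distinguished.
by move=> /(_ _ (ex_intro2 _ _ c0 c0U erefl)).
Qed.

(** The projection kills the unknown multiple of [J] and fixes the vertical part of [U], which is
    orthogonal to [J]. *)
Lemma nabla_distinguished p J U A : tangentZ Q p J U -> smooth_end p A ->
  qdot J J = 1 -> qdot (vert D p J U) J = 0 ->
  nabla Q D p J U (distinguished A)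
  = Theta_proj J (cov_end D p U.1 A) - qdot (A p) J *: vert D p J U.
Proof.
move=> tU sA J1 V0; have [r rE] := pull_cov_distinguished tU sA.
rewrite /nabla rE !Theta_projD Theta_projZ Theta_proj_self // scaler0 addr0.
by rewrite -scaleNr Theta_projZ (Theta_proj_id V0).
Qed.

End TwistorCurves.

(** * Derivatives and smoothness of combinations of a moving frame *)

Section Combinations.
Context {R : realType} {m : nat}.

Lemma derive_qdot_scale (V : normedModType R) (f g : V -> 'M[R]_m) y v fy gy f' :
  differentiable f y -> differentiable g y -> f y = fy -> g y = gy ->
  'D_v f y = f' ->
  differentiable (fun z => qdot (g z) (f z) *: f z) y /\
  exists r, 'D_v (fun z => qdot (g z) (f z) *: f z) y = qdot gy fy *: f' + r *: fy.
Proof.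
move=> df dg <- <- <-; have [dq _] := derive_qdot v dg df.
have [ds Ds] := derive_scale v dq df; split => //.
by exists ('D_v (fun z => qdot (g z) (f z) : R^o) y).
Qed.

Lemma derive_add (V W : normedModType R) (f g : V -> W) y v :
  differentiable f y -> differentiable g y ->
  differentiable (fun z => f z + g z) y /\
  'D_v (fun z => f z + g z) y = 'D_v f y + 'D_v g y.
Proof.
move=> df dg; split; first exact: differentiableD.
by apply: deriveD; exact: diff_derivable.
Qed.

Lemma derive_comb (V : normedModType R) (f1 f2 f3 : V -> R^o)
    (h1 h2 h3 : V -> 'M[R]_m) y v :
  differentiable f1 y -> differentiable f2 y -> differentiable f3 y ->
  differentiable h1 y -> differentiable h2 y -> differentiable h3 y ->
  'D_v (fun z => comb (h1 z) (h2 z) (h3 z) (f1 z) (f2 z) (f3 z)) y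
  = comb ('D_v h1 y) ('D_v h2 y) ('D_v h3 y) (f1 y) (f2 y) (f3 y)
    + comb (h1 y) (h2 y) (h3 y) ('D_v f1 y) ('D_v f2 y) ('D_v f3 y).
Proof.
move=> df1 df2 df3 dh1 dh2 dh3.
have [d1 D1] := derive_scale v df1 dh1.
have [d2 D2] := derive_scale v df2 dh2.
have [d3 D3] := derive_scale v df3 dh3.
transitivity ('D_v (fun z => f1 z *: h1 z) y + 'D_v (fun z => f2 z *: h2 z) y
              + 'D_v (fun z => f3 z *: h3 z) y).
  have [d12 e1] := derive_add v d1 d2; have [_ e2] := derive_add v d12 d3.
  exact: etrans e2 (congr1 (fun Z => Z + _) e1).
apply: etrans (congr2 +%R (congr2 +%R D1 D2) D3) _; rewrite /comb.
move: ('D_v h1 y) ('D_v h2 y) ('D_v h3 y) ('D_v f1 y) ('D_v f2 y) ('D_v f3 y).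
move: (h1 y) (h2 y) (h3 y) (f1 y) (f2 y) (f3 y) => *.
by apply/matrixP => i j; rewrite !mxE; ring.
Qed.

Lemma smooth_near_comb (V : normedModType R) (f1 f2 f3 : V -> R^o)
    (h1 h2 h3 : V -> 'M[R]_m) y :
  smooth_near y f1 -> smooth_near y f2 -> smooth_near y f3 ->
  smooth_near y h1 -> smooth_near y h2 -> smooth_near y h3 ->
  smooth_near y (fun z => comb (h1 z) (h2 z) (h3 z) (f1 z) (f2 z) (f3 z)).
Proof.
move=> *; apply: smooth_nearD; last exact: smooth_nearZ.
by apply: smooth_nearD; exact: smooth_nearZ.
Qed.

Lemma smooth_near_id (V : normedModType R) (x : V) : smooth_near x (@id V).
Proof.
exists setT; split => // [|[|k]]; first exact: openT.
  by move=> y _; exact: cvg_id.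
split=> [y _|v]; first by have [] := is_diff_id y.
rewrite (_ : 'D_v _ = fun=> v); first exact: Ck_cst.
by apply/funext => y; exact: derive_id.
Qed.

Lemma end_coord_comb (M : manifold R m) (p q : M) (A1 A2 A3 : 'M[R]_m) x1 x2 x3 :
  end_coord p q (comb A1 A2 A3 x1 x2 x3)
  = comb (end_coord p q A1) (end_coord p q A2) (end_coord p q A3) x1 x2 x3.
Proof.
by rewrite /end_coord /comb !mulmxDr !mulmxDl -!scalemxAr -!scalemxAl.
Qed.

Lemma end_coord_frame (M : manifold R m) (p q : M) (Qq : set 'M[R]_m)
    (K1 K2 K3 a : 'M[R]_m) :
  let e := end_coord p q in (0 < m)%N -> tcoord p q \in unitmx ->
  admissible Qq K1 K2 K3 -> Qq a ->
  comb (e K1) (e K2) (e K3)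
    (qdot (e a) (e K1)) (qdot (e a) (e K2)) (qdot (e a) (e K3)) = e a.
Proof.
move=> e m0 ut adm Qa; rewrite !qdot_end_coord // -end_coord_comb.
by rewrite -(mem_combE m0 adm Qa).
Qed.

Lemma cov_ext_end_comb (M : manifold R m) (D : connection M) p v
    (A1 A2 A3 : 'M[R]_m) x1 x2 x3 :
  cov_end D p v (ext_end p (comb A1 A2 A3 x1 x2 x3))
  = comb (cov_end D p v (ext_end p A1)) (cov_end D p v (ext_end p A2))
      (cov_end D p v (ext_end p A3)) x1 x2 x3.
Proof.
rewrite !cov_ext_endE /comb !mulmxDr !mulmxDl -!scalemxAr -!scalemxAl.
move: (christoffel D p v) => G; move: (G *m A1) (G *m A2) (G *m A3).
move: (A1 *m G) (A2 *m G) (A3 *m G) => *.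
by apply/matrixP => i j; rewrite !mxE; ring.
Qed.

End Combinations.

(** * Vertical parts of tangent vectors of Z *)

Section TwistorTangent.
Context {R : realType} {m : nat} {M : manifold R m}.
Variables (Q : M -> set 'M[R]_m) (D : connection M).
Hypotheses (m_gt0 : (0 < m)%N) (presQ : preserves Q D).
Variables (p : M) (J1 J2 J3 : M -> 'M[R]_m).
Hypotheses (s1 : smooth_end p J1) (s2 : smooth_end p J2) (s3 : smooth_end p J3).
Hypothesis admJ : \forall q \near p, admissible (Q q) (J1 q) (J2 q) (J3 q).
Implicit Types (J V : 'M[R]_m) (U : 'cV[R]_m * 'M[R]_m).

Let admp : admissible (Q p) (J1 p) (J2 p) (J3 p) := nbhs_singleton admJ.

Let mem_cov v : [/\ Q p (cov_end D p v J1), Q p (cov_end D p v J2)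
  & Q p (cov_end D p v J3)].
Proof.
by split; apply: presQ => //; apply: filterS admJ => q /mem_frame[].
Qed.

(** Along a curve in Z the fiber component equals the sum of <a, J_i> J_i. Differentiating this and
    adding the connection term gives the sum of <J, J_i> D_v J_i + r_i J_i, which lies in Q because
    [D] preserves Q. *)
Lemma vert_mem J U : twistor Q (p, J) -> tangentZ Q p J U ->
  Q p (vert D p J U) /\ qdot (vert D p J U) J = 0.
Proof.
move=> [/= QJ J1'] [c cU]; have [x0 a0] := zcurve0 cU.
have [[dx Dx] [da Da]] := zcurve_derive cU.
have nc := zcurve_near cU.
have [d1 D1 e1] := zcurve_end cU s1.
have [d2 D2 e2] := zcurve_end cU s2.
have [d3 D3 e3] := zcurve_end cU s3.
pose x := base_path p c; pose a := fiber_path p c; split; last first.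
  (* Orthogonality: the connection term is a commutator with [J], and the velocity of a curve of
     unit vectors is orthogonal to its position. *)
  rewrite /vert qdotDl qdot_cov_ext_end addr0.
  have [_] := derive_qdot (1 : R^o) da da.
  rewrite (@near_eq_derive _ _ R^o _ (cst (1 : R^o))).
    rewrite derive_cst Da a0 qdotC => e; lra.
  apply: filterS nc => t [_ ut [_ at1]].
  exact: etrans (qdot_end_coord _ _ ut) at1.
have [t1 [r1 T1]] := derive_qdot_scale d1 da e1 a0 D1.
have [t2 [r2 T2]] := derive_qdot_scale d2 da e2 a0 D2.
have [t3 [r3 T3]] := derive_qdot_scale d3 da e3 a0 D3.
have nadm : \forall t \near (0 : R), 
    admissible (Q (c t).1) (J1 (c t).1) (J2 (c t).1) (J3 (c t).1).
  have := near_chartV (mem_dom p) admJ; rewrite -x0 => nx.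
  have := differentiable_continuous dx nx.
  by apply: filterS2 nc => t [xt _ _]; rewrite /= xt.
have aE : \forall t \near (0 : R^o),
    qdot (a t) (end_in p J1 (x t)) *: end_in p J1 (x t)
    + qdot (a t) (end_in p J2 (x t)) *: end_in p J2 (x t)
    + qdot (a t) (end_in p J3 (x t)) *: end_in p J3 (x t) = a t.
  apply: filterS2 nc nadm => t [xt ut [Qc _]] adm.
  rewrite /end_in xt; exact: (end_coord_frame m_gt0 ut adm Qc).
have [t12 DE1] := derive_add (1 : R^o) t1 t2.
have [_ DE2] := derive_add (1 : R^o) t12 t3.
have U2 : U.2 = qdot J (J1 p) *: 'D_(U.1) (end_in p J1) (chart p p) + r1 *: J1 p
  + (qdot J (J2 p) *: 'D_(U.1) (end_in p J2) (chart p p) + r2 *: J2 p)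
  + (qdot J (J3 p) *: 'D_(U.1) (end_in p J3) (chart p p) + r3 *: J3 p).
  apply: etrans (esym Da) _; apply: etrans (esym (near_eq_derive (1 : R^o) aE)) _.
  apply: etrans DE2 _; exact: (congr2 +%R (etrans DE1 (congr2 +%R T1 T2)) T3).
have [C1 C2 C3] := mem_cov U.1.
(* The [J] in the connection term is expanded in the frame as well, so that each coordinate
   derivative of J_i meets its connection term. *)
rewrite /vert U2 {4}(mem_combE m_gt0 admp QJ) cov_ext_end_comb.
rewrite (_ : _ + _ = qdot J (J1 p) *: cov_end D p U.1 J1 +
  (qdot J (J2 p) *: cov_end D p U.1 J2 + (qdot J (J3 p) *: cov_end D p U.1 J3
   + comb (J1 p) (J2 p) (J3 p) r1 r2 r3))).
  apply: (mem_lin admp _ C1); apply: (mem_lin admp _ C2).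
  apply: (mem_lin admp _ C3); exact: comb_mem admp _ _ _.
rewrite (cov_end_ext_end _ _ s1) (cov_end_ext_end _ _ s2) (cov_end_ext_end _ _ s3).
move: (cov_end D p _ _) (cov_end D p _ _) (cov_end D p _ _) => X1 X2 X3.
move: ('D_(U.1) _ _) ('D_(U.1) _ _) ('D_(U.1) _ _) => Y1 Y2 Y3.
move: (qdot _ _) (qdot _ _) (qdot _ _) => q1 q2 q3.
by apply/matrixP => i j; rewrite !mxE; ring.
Qed.

End TwistorTangent.

(** * Great circles on the unit sphere of R^3 *)

Section SphereCurve.
Context {R : realType}.

(* For l = 0 the convention y / 0 = 0 makes this the constant x. *)
Definition circle (l x y : R) (t : R^o) : R^o :=
  x * cos (l * t) + y / l * sin (l * t).

Lemma circle0 l x y : circle l x y 0 = x.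
Proof. by rewrite /circle mulr0 cos0 sin0 mulr0 addr0 mulr1. Qed.

(** For [l = 0] the curve is constant, so the prescribed velocity has to be 0 as well. *)
Lemma derive_circle0 l x y : (l = 0 -> y = 0) ->
  differentiable (circle l x y) 0 /\ 'D_1 (circle l x y) 0 = y.
Proof.
move=> ly; have [d D] := derive1_cos_sin x (y / l) l 0.
split; first exact/derivable1_diffP.
apply: etrans D _; rewrite mulr0 cos0 sin0 mulr0 addr0 mulr1.
by have [l0|l0] := eqVneq l 0; [rewrite l0 mulr0 ly|rewrite divfK].
Qed.

Lemma smooth_circle l x y : smooth_near (0 : R^o) (circle l x y).
Proof. by exists setT; split => // [|k]; [exact: openT|exact: Ck_cos_sin]. Qed.

(** For nonzero [l] the vectors x and y / l are orthonormal and the triple traces the great circle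
    through them; for [l = 0] it stays at x. *)
Lemma circle_unit l x1 x2 x3 y1 y2 y3 t :
  x1 * x1 + x2 * x2 + x3 * x3 = 1 -> x1 * y1 + x2 * y2 + x3 * y3 = 0 ->
  y1 * y1 + y2 * y2 + y3 * y3 = l * l ->
  circle l x1 y1 t * circle l x1 y1 t + circle l x2 y2 t * circle l x2 y2 t
    + circle l x3 y3 t * circle l x3 y3 t = 1.
Proof.
move=> xx xy yy; rewrite /circle.
have cs := cos2Dsin2 (l * t); rewrite !expr2 in cs.
have [l0|l0] := eqVneq l 0.
  by rewrite l0 mul0r cos0 sin0 !mulr0 !addr0 !mulr1.
move: (cos _) (sin _) cs => c s cs.
have yyl : y1 / l * (y1 / l) + y2 / l * (y2 / l) + y3 / l * (y3 / l) = 1.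
  transitivity ((y1 * y1 + y2 * y2 + y3 * y3) / (l * l)); first by field.
  by rewrite yy divff // mulf_neq0.
have xyl : x1 * (y1 / l) + x2 * (y2 / l) + x3 * (y3 / l) = 0.
  transitivity ((x1 * y1 + x2 * y2 + x3 * y3) / l); first by field.
  by rewrite xy mul0r.
move: (y1 / l) (y2 / l) (y3 / l) yyl xyl => z1 z2 z3 zz xz.
transitivity ((x1 * x1 + x2 * x2 + x3 * x3) * (c * c)
  + (z1 * z1 + z2 * z2 + z3 * z3) * (s * s)
  + 2 * (c * s) * (x1 * z1 + x2 * z2 + x3 * z3)); first ring.
by rewrite xx zz xz mulr0 addr0 !mul1r.
Qed.

End SphereCurve.

(** * Tangent vectors of Z with prescribed horizontal and vertical parts *)

Section TangentExistence.
Context {R : realType} {m : nat} {M : manifold R m}.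
Variables (Q : M -> set 'M[R]_m) (D : connection M).
Hypotheses (m_gt0 : (0 < m)%N) (presQ : preserves Q D).
Variables (p : M) (J1 J2 J3 : M -> 'M[R]_m).
Hypotheses (s1 : smooth_end p J1) (s2 : smooth_end p J2) (s3 : smooth_end p J3).
Hypothesis admJ : \forall q \near p, admissible (Q q) (J1 q) (J2 q) (J3 q).
Implicit Types (J V : 'M[R]_m) (U : 'cV[R]_m * 'M[R]_m).

Let admp : admissible (Q p) (J1 p) (J2 p) (J3 p) := nbhs_singleton admJ.

(** The curve moves along a chart line with velocity [v] while its frame coefficients follow the
    great circle from x with velocity y. The product rule yields the two summands of the fiber
    velocity. *)
Lemma tangentZ_frame v x1 x2 x3 y1 y2 y3 :
  x1 * x1 + x2 * x2 + x3 * x3 = 1 -> x1 * y1 + x2 * y2 + x3 * y3 = 0 ->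
  tangentZ Q p (comb (J1 p) (J2 p) (J3 p) x1 x2 x3)
    (v, comb ('D_v (end_in p J1) (chart p p)) ('D_v (end_in p J2) (chart p p))
          ('D_v (end_in p J3) (chart p p)) x1 x2 x3
        + comb (J1 p) (J2 p) (J3 p) y1 y2 y3).
Proof.
(* The angular speed is the length of y; if it is 0 then y = 0, as [derive_circle0] requires. *)
move=> xx xy; pose l := Num.sqrt (y1 * y1 + y2 * y2 + y3 * y3).
have sq (z : R) : 0 <= z * z by rewrite -expr2 sqr_ge0.
have ll : y1 * y1 + y2 * y2 + y3 * y3 = l * l.
  by rewrite -[RHS]expr2 sqr_sqrtr // !addr_ge0.
have l0 : l = 0 -> [/\ y1 = 0, y2 = 0 & y3 = 0].
  move=> l0; rewrite l0 mulr0 in ll.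
  move: ll (sq y1) (sq y2) (sq y3) => ll q1 q2 q3.
  have z (z : R) : z * z = 0 -> z = 0 by move=> /eqP; rewrite mulf_eq0 orbb => /eqP.
  by split; apply: z; lra.
pose q (t : R^o) := chart p p + t *: v.
pose f1 := circle l x1 y1; pose f2 := circle l x2 y2; pose f3 := circle l x3 y3.
pose c (t : R) := (chartV p (q t),
  comb (J1 (chartV p (q t))) (J2 (chartV p (q t))) (J3 (chartV p (q t)))
    (f1 t) (f2 t) (f3 t)).
pose h (K : M -> 'M[R]_m) (t : R^o) := end_in p K (q t).
(* The expression of [c] in the coordinates at [p]; the two agree as long as the line stays in the
   image of the chart. *)
pose z (t : R^o) := (q t, comb (h J1 t) (h J2 t) (h J3 t) (f1 t) (f2 t) (f3 t)).
have q0 : q 0 = chart p p by rewrite /q scale0r addr0.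
have [dq Dq] := derive_line (chart p p) v 0 1; rewrite scale1r in Dq.
have nq (P : set 'cV[R]_m) : (\forall y \near chart p p, P y) ->
    \forall t \near (0 : R), P (q t).
  by rewrite -q0 => nP; exact: (differentiable_continuous dq nP).
have sh K : smooth_end p K -> smooth_near (0 : R^o) (h K).
  by move=> sK; exact: smooth_near_line.
have dh K : smooth_end p K -> differentiable (h K) 0 /\
    'D_1 (h K) 0 = 'D_v (end_in p K) (chart p p).
  move=> sK; have dK : differentiable (end_in p K) (q 0).
    by rewrite q0; exact: smooth_near_differentiable.
  split; first exact: (differentiable_comp dq dK).
  apply: etrans (derive_comp (1 : R^o) dq dK) _.
  exact: (congr2 (fun w y => 'D_w (end_in p K) y) Dq q0).
have zc : \forall t \near (0 : R^o), z t = (zcoord p \o c) t.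
  apply: filterS (nq _ (near_image (mem_dom p))) => t it.
  rewrite /zcoord /= chartVK //; congr pair; exact/esym/end_coord_comb.
have sc : smooth_near (0 : R^o) (fun t : R^o =>
    comb (h J1 t) (h J2 t) (h J3 t) (f1 t) (f2 t) (f3 t)).
  by apply: smooth_near_comb; first [exact: smooth_circle|exact: sh].
exists c; split.
- by rewrite /c q0 chartV_chart /f1 /f2 /f3 !circle0.
- apply: filterS2 (nq _ (near_image (mem_dom p)))
    (nq _ (near_chartV (mem_dom p) admJ)) => t it adm.
  split; first exact: dom_chartV.
  split; first exact: (comb_mem adm).
  exact: etrans (qdot_comb m_gt0 adm _ _ _ _ _ _) (circle_unit _ xx xy ll).
- apply: smooth_near_eq zc _; apply: smooth_near_pair sc.
  exact: (@smooth_near_line R _ _ (chart p p) v id (smooth_near_id _)).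
rewrite derive1E; apply: etrans (esym (near_eq_derive (1 : R^o) zc)) _.
have [dh1 Dh1] := dh _ s1; have [dh2 Dh2] := dh _ s2; have [dh3 Dh3] := dh _ s3.
have [df1 Df1] : differentiable f1 0 /\ 'D_1 f1 0 = y1.
  by apply: derive_circle0 => /l0[].
have [df2 Df2] : differentiable f2 0 /\ 'D_1 f2 0 = y2.
  by apply: derive_circle0 => /l0[].
have [df3 Df3] : differentiable f3 0 /\ 'D_1 f3 0 = y3.
  by apply: derive_circle0 => /l0[].
have Dc := derive_comb (1 : R^o) df1 df2 df3 dh1 dh2 dh3.
apply: etrans (derive_pair _ dq (smooth_near_differentiable sc)) _.
have h0 K : h K 0 = K p by rewrite /h q0 end_inpp.
congr pair; first exact: Dq.
have ceq (A1 A2 A3 B1 B2 B3 : 'M[R]_m) a1 a2 a3 b1 b2 b3 : A1 = B1 -> A2 = B2 ->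
    A3 = B3 -> a1 = b1 -> a2 = b2 -> a3 = b3 ->
    comb A1 A2 A3 a1 a2 a3 = comb B1 B2 B3 b1 b2 b3.
  by move=> -> -> -> -> -> ->.
apply: etrans Dc _; apply: (congr2 +%R).
  exact: (ceq _ _ _ _ _ _ _ _ _ _ _ _ Dh1 Dh2 Dh3
    (circle0 _ _ _) (circle0 _ _ _) (circle0 _ _ _)).
exact: (ceq _ _ _ _ _ _ _ _ _ _ _ _ (h0 J1) (h0 J2) (h0 J3) Df1 Df2 Df3).
Qed.

(** Extend [J] to the field [B] with constant coefficients in the frame. The required fiber velocity
    is then d_v B + (V - D_v B), and V - D_v B is a vector of Q orthogonal to [J], so
    [tangentZ_frame] applies. *)
Lemma tangentZ_ex v J V : twistor Q (p, J) -> Q p V -> qdot V J = 0 ->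
  tangentZ Q p J (v, V - cov_end D p v (ext_end p J)).
Proof.
move=> [/= QJ J1'] QV VJ.
have [x1 [x2 [x3 JE]]] := (combP admp J).1 QJ.
pose B q := comb (J1 q) (J2 q) (J3 q) x1 x2 x3.
have BE x : end_in p B x
    = comb (end_in p J1 x) (end_in p J2 x) (end_in p J3 x) x1 x2 x3.
  exact: end_coord_comb.
have sB : smooth_end p B.
  apply: (smooth_near_eq (f := fun x =>
    comb (end_in p J1 x) (end_in p J2 x) (end_in p J3 x) x1 x2 x3)).
    by near=> x; rewrite BE.
  apply: smooth_near_comb => //; exact: smooth_near_cst.
have xx : x1 * x1 + x2 * x2 + x3 * x3 = 1.
  by rewrite -(qdot_comb m_gt0 admp) -JE.
have QB : Q p (cov_end D p v B).
  by apply: presQ => //; apply: filterS admJ => q adm; exact: comb_mem adm _ _ _.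
have Bp : B p = J by rewrite JE.
have BJ : qdot (cov_end D p v B) J = 0.
  rewrite -Bp; apply: qdot_cov_unit => //.
  by apply: filterS admJ => q adm; rewrite /B (qdot_comb m_gt0 adm).
have QW : Q p (- 1 *: cov_end D p v B + V) by exact: (mem_lin admp).
have [y1 [y2 [y3 WE]]] := (combP admp _).1 QW.
have xy : x1 * y1 + x2 * y2 + x3 * y3 = 0.
  rewrite -(qdot_comb m_gt0 admp) -JE -WE qdotC qdotDl qdotZl BJ VJ.
  by rewrite mulr0 addr0.
have := tangentZ_frame v xx xy; rewrite -JE -WE.
congr tangentZ; congr pair.
rewrite (cov_end_ext_end _ _ sB) Bp.
have d0 (z : R) : differentiable (cst z : 'cV[R]_m -> R^o) (chart p p).
  exact: differentiable_cst.
have := derive_comb v (d0 x1) (d0 x2) (d0 x3) (smooth_near_differentiable s1)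
  (smooth_near_differentiable s2) (smooth_near_differentiable s3).
rewrite !derive_cst /= (_ : (fun z => _) = end_in p B); last first.
  by apply/funext => x; rewrite BE.
rewrite [X in _ + X](_ : _ = 0) ?addr0; last by rewrite /comb !scale0r !addr0.
move=> <-; move: ('D_v _ _) (cov_end D p _ _) => X Y.
by rewrite scaleN1r addrA opprD addNKr addrC.
Unshelve. all: by end_near. Qed.

End TangentExistence.

(** * The operator dbar on distinguished sections *)

Section Dbar.
Context {R : realType} {m : nat} {M : manifold R m}.
Variables (Q : M -> set 'M[R]_m) (D : connection M).
Hypotheses (m_gt0 : (0 < m)%N) (qQ : quaternionic_structure Q).
Hypothesis presQ : preserves Q D.
Implicit Types (p : M) (J V : 'M[R]_m) (U : 'cV[R]_m * 'M[R]_m).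

Lemma twistor_tangent_lift p J v V : twistor Q (p, J) -> Q p V -> qdot V J = 0 ->
  tangentZ Q p J (v, V - cov_end D p v (ext_end p J)).
Proof.
have [/(_ p)[J1 [J2 [J3 [s1 s2 s3 adm]]]] _] := qQ.
exact: (tangentZ_ex m_gt0 presQ s1 s2 s3 adm).
Qed.

Lemma vert_vertical p J U : twistor Q (p, J) -> tangentZ Q p J U ->
  Q p (vert D p J U) /\ qdot (vert D p J U) J = 0.
Proof.
have [/(_ p)[J1 [J2 [J3 [s1 s2 s3 adm]]]] _] := qQ.
exact: (vert_mem m_gt0 presQ s1 s2 s3 adm).
Qed.

(** By [comb_mul], the product of [J] with an orthogonal [V] is a pure cross product; composition
    with [J] thus maps the vertical tangent space to itself. *)
Lemma twistor_square p J V : twistor Q (p, J) -> Q p V -> qdot V J = 0 ->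
  [/\ J *m J = - 1%:M, Q p (J *m V) & qdot (J *m V) J = 0].
Proof.
have [/(_ p)[J1 [J2 [J3 [_ _ _ /nbhs_singleton adm]]]] _] := qQ.
move=> [/= /(combP adm)[x1 [x2 [x3 ->]]] JJ] /(combP adm)[y1 [y2 [y3 ->]]].
move: JJ; rewrite !(qdot_comb m_gt0 adm) => xx yx.
have xy : x1 * y1 + x2 * y2 + x3 * y3 = 0 by rewrite -yx; ring.
split.
- rewrite (comb_mul adm) xx raddfN /= /comb.
  by rewrite ![_ * x1]mulrC [x3 * x2]mulrC !subrr !scale0r !addr0.
- by rewrite (comb_mul adm) xy oppr0 raddf0 add0r; exact: comb_mem adm _ _ _.
- rewrite (comb_mul adm) xy oppr0 raddf0 add0r (qdot_comb m_gt0 adm); ring.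
Qed.

(** This brings the image of [U] into the form of [twistor_tangent_lift], with vertical part J o
    V. *)
Lemma cplxZ_E p J U : cplxZ D p J U =
  (J *m U.1, J *m vert D p J U - cov_end D p (J *m U.1) (ext_end p J)).
Proof. by rewrite /cplxZ /hlift; congr pair; rewrite /= ?addr0 // addrC. Qed.

Lemma dbar_distinguished p J U A : twistor Q (p, J) -> tangentZ Q p J U ->
  smooth_end p A -> dbar Q D p J U (distinguished A) =
  2^-1 *: (Theta_proj J (cov_end D p U.1 A)
           + J *m Theta_proj J (cov_end D p (J *m U.1) A)).
Proof.
move=> tw tU sA; have [QV VJ] := vert_vertical tw tU.
have [JJ QJV JVJ] := twistor_square tw QV VJ.
have J1 : qdot J J = 1 by case: tw.
have tU' : tangentZ Q p J (cplxZ D p J U).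
  by rewrite cplxZ_E; exact: twistor_tangent_lift.
have vE : vert D p J (cplxZ D p J U) = J *m vert D p J U.
  by rewrite {1}/vert cplxZ_E /= subrK.
have V'J : qdot (vert D p J (cplxZ D p J U)) J = 0 by rewrite vE.
have N1 := nabla_distinguished tU sA J1 VJ.
have N2 := nabla_distinguished tU' sA J1 V'J.
have U1 : (cplxZ D p J U).1 = J *m U.1 by rewrite cplxZ_E.
rewrite /dbar N1 N2 vE U1; congr (_ *: _).
(* Composing the second vertical term with [J] turns J o V into -V, which cancels the first one. *)
rewrite mulmxBr -scalemxAr mulmxA JJ mulNmx mul1mx scalerN opprK.
by rewrite addrACA [X in _ + X]addrC subrr addr0.
Qed.

Lemma dbar_penrose A : section_of Q A ->
  dbar_holomorphic Q D (distinguished A) <-> (forall p v, penrose Q D A p v = 0).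
Proof.
move=> hA.
have cot p : cotensor (Q p) (fun v => cov_end D p v A).
  split=> [a u v|v]; first by apply: cov_end_lin; case: (hA p).
  apply: presQ; first by case: (hA p).
  by apply: nearW => q; case: (hA q).
(* At each point both conditions say that v |-> D_v A lies in E^* (x) H. *)
have key p : (forall v, penrose Q D A p v = 0) <->
    (forall J, Q p J -> qdot J J = 1 -> forall v, Theta_proj J (cov_end D p v A)
      + J *m Theta_proj J (cov_end D p (J *m v) A) = 0).
  have [/(_ p)[J1 [J2 [J3 [_ _ _ /nbhs_singleton adm]]]] _] := qQ.
  apply: (iff_trans (ES3H_proj0P m_gt0 adm (cot p))).
  exact: iff_sym (EH_rotationP m_gt0 adm (cot p)).
split=> [hol p|pen p J tw U tU].
  apply/key => J QJ JJ v; have tw : twistor Q (p, J) by [].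
  have [/(_ p)[J1 [J2 [J3 [_ _ _ /nbhs_singleton adm]]]] _] := qQ.
  have Q0 : Q p 0.
    by have := comb_mem adm 0 0 0; rewrite /comb !scale0r !addr0.
  (* The horizontal lift, with vertical part 0, realizes an arbitrary [v] as the projection of a
     tangent vector of Z. *)
  have tU := twistor_tangent_lift v tw Q0 (qdot0l J).
  have := hol p J tw _ tU; rewrite dbar_distinguished //; last by case: (hA p).
  by move=> /eqP; rewrite scaler_eq0 invr_eq0 pnatr_eq0 /= => /eqP.
rewrite dbar_distinguished //; last by case: (hA p).
have [QJ JJ] := tw; rewrite (key p).1 ?scaler0 //.
Qed.

End Dbar.

Theorem proposition5 (R : realType) (n : nat) (hn : (2 <= n)%N)
  (M : manifold R (4 * n)) (hM : connected [set: M])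
  (Q : M -> set 'M[R]_(4 * n)) (hQ : quaternionic_structure Q)
  (D : connection M) (hD : quaternionic_connection Q D)
  (hsd : self_dual Q D)
  (A : M -> 'M[R]_(4 * n)) (hA : section_of Q A) :
  dbar_holomorphic Q D (distinguished A) <->
  (forall p v, penrose Q D A p v = 0).
Proof.
have m_gt0 : (0 < 4 * n)%N by rewrite muln_gt0 /=; apply: leq_trans hn.
by apply: dbar_penrose => //; case: hD.
Qed.
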